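(* (Pontryagin duality.) Let $R$ be a commutative ring with unit, let $n\ge0$, and let $\mathcal S_n$ be the strong category of $n$-fold filtered $R$-modules built from the finite $R$-modules. For every object $A$ of $\mathcal S_n$ there is a canonical isomorphism $\hat{\hat A}\cong\bar A$ of the double Pontryagin dual with the completion of $A$, under which the natural map $\delta:A\to\hat{\hat A}$ is the natural injection $A\to\bar A$. In particular, if $A$ is complete, then $\delta:A\to\hat{\hat A}$ is a natural isomorphism.
   Context: Filtrations. A partially ordered set is filtering if any two elements have a lower bound and an upper bound in it. A filtration on an object $A$ of an abelian category $\mathcal A$ is, up to natural isomorphism, a family of subobjects $F(i)\subset A$ indexed by a filtering partially ordered set $I_F$ with $F(i)\subset F(j)$ for $i\le j$, $\bigcap_iF(i)=0$ (projective limit zero), $\bigcup_iF(i)=A$ (injective limit $A$). An order preserving map $\phi:I\to J$ of filtering sets is cofinal if for every $j\in J$ there are $i_1,i_2\in I$ with $\phi(i_1)\le j\le\phi(i_2)$. A sub-filtration of $F$ is a pair $(\phi,S)$ with $\phi:I_S\to I_F$ cofinal and $S$ a filtration with $S\cong F\circ\phi$. Let $\sim$ be the equivalence relation generated by $F\sim S$ whenever $S$ is a sub-filtration of $F$; $[F]$ is the class of $F$. All filtrations have countable index set. The categories $\mathcal A_n$. Here $\mathcal A$ is the category of $R$-modules and $\mathcal A_0$ the full subcategory of modules that are finite as sets. Objects $A$ of $\mathcal A_0$ are regarded as trivially filtered ($I_F=\{0,\infty\}$, $F(0)=0$, $F(\infty)=A$). For $n\ge1$, an object of $\mathcal A_n$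 is a class $(A,[F])$ of filtrations together with a class of filtrations $[E_{i,j}]$ on $F(j)/F(i)$ for all $i\le j$, such that $(F(j)/F(i),[E_{i,j}])$ is an object of $\mathcal A_{n-1}$ and the natural maps $F(i)/F(j)\to F(k)/F(l)$ ($j\le i$, $l\le k$, $k\ge i$, $l\ge j$) are morphisms in $\mathcal A_{n-1}$. A morphism $(A,[F])\to(B,[G])$ in $\mathcal A_n$ is a morphism $\phi:A\to B$ in $\mathcal A$ such that for every $i\in I_F$, $j\in I_G$ there exist $i_0\le i$, $j_0\ge j$ such that for all $i'\le i_0$, $j'\ge j_0$ one has $\phi(F(i'))\subset G(j)$, $\phi(F(i))\subset G(j')$, and the induced map $F(i)/F(i')\to G(j')/G(j)$ is a morphism in $\mathcal A_{n-1}$. The strong categories. A sequence $0\to A\xrightarrow{\alpha}B\xrightarrow{\beta}C\to0$ in $\mathcal A_n$ is exact if $\alpha$ is the kernel of $\beta$ and $\beta$ the cokernel of $\alpha$. A morphism $\phi$ in $\mathcal A_n$ is quasi-strong if the canonical map $\operatorname{coker}(\ker\phi)\to\ker(\operatorname{coker}\phi)$ is an isomorphism. Put $\mathcal S_0=\mathcal A_0$. For $n\ge1$, $(A,[F])$ in $\mathcal A_n$ is strong if for all $i\le j$ the quotient $F(j)/F(i)$ is strong in $\mathcal A_{n-1}$ and for all $i\le j\le k$ the sequence $F(j)/F(i)\to F(k)/F(i)\to F(k)/F(j)$ is exact in $\mathcal A_{n-1}$. A morphism is strong if it is quasi-strong with strong source and target. $\mathcal S_n$ is the category of strong objects and strong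 morphisms. Completion. For $n=0$, $\bar A=A$. For $n>0$, $\bar A=\varinjlim_j\varprojlim_i\overline{F(j)/F(i)}$, with filtration $\bar F(j)=\varprojlim_i\overline{F(j)/F(i)}$ and $\bar F(j)/\bar F(i)\cong\overline{F(j)/F(i)}$; the natural injection $A\to\bar A$ is the identity for $n=0$ and the limit of the injections $F(j)/F(i)\to\overline{F(j)/F(i)}$ for $n>0$. $A$ is complete if $A\to\bar A$ is an isomorphism. Dual. For $n=0$, $\hat A=\operatorname{Hom}_{\mathbb Z}(A,\mathbb Q/\mathbb Z)$ with $(r\alpha)(a)=\alpha(ra)$, and $\delta(a)(\alpha)=\alpha(a)$. For $n>0$, $\hat A=\varinjlim_i\varprojlim_j\widehat{F(j)/F(i)}$, with filtration $\hat F(i)=\varprojlim_j\widehat{F(j)/F(i)}$ indexed by $I_F$ with the opposite order; one has $\hat F(i)/\hat F(j)=\widehat{F(j)/F(i)}$ for $i\le j$, which gives the $\mathcal S_{n-1}$-structure on the quotients. The map $\delta:A\to\hat{\hat A}$ is obtained for $n>0$ by taking limits of the maps $\delta$ for the quotients $F(j)/F(i)$. *)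

(* Defs.v *)
From HB Require Import structures.
From mathcomp Require Import all_boot all_order all_algebra.
From mathcomp Require Import generic_quotient ring_quotient.
From mathcomp Require Import boolp classical_sets functions cardinality.

Set Implicit Arguments.
Unset Strict Implicit.
Unset Printing Implicit Defensive.

Import Order.TTheory GRing.Theory Num.Theory.
Import Quotient.
Local Open Scope order_scope.
Local Open Scope classical_set_scope.
Local Open Scope quotient_scope.
Local Open Scope ring_scope.

Section Modules.
Variable R : comPzRingType.

(* The linear map determined by the property [P]; the junk value 0 is taken
   only when [P] does not determine exactly one map. *)
Definition the_linear (U V : lmodType R) (P : set {linear U -> V}) :
    {linear U -> V} :=
  match pselect (exists g, P g /\ forall g', P g' -> g' =1 g) with
  | left e => projT1 (cid e)
  | right _ => \0
  end.

Record submodule (V : lmodType R) := Submodule {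
  smod_set : set V;
  smod_0 : smod_set 0;
  smod_lin : forall a u v, smod_set u -> smod_set v -> smod_set (a *: u + v)
}.

Section SubQuotient.
Variables (V : lmodType R) (N : submodule V).

Definition smod_pred : {pred V} := fun v => `[< smod_set N v >].

Fact smod_pred_closed : GRing.submod_closed smod_pred.
Proof.
split=> [|a u v /asboolP Nu /asboolP Nv]; apply/asboolP; first exact: smod_0.
exact: smod_lin.
Qed.
HB.instance Definition _ :=
  GRing.isSubmodClosed.Build R V smod_pred smod_pred_closed.

Definition submod := {v : V | v \in smod_pred}.
HB.instance Definition _ := SubChoice.on submod.
HB.instance Definition _ := [SubChoice_isSubLmodule of submod by <:].

Definition quomod := {quot smod_pred}.
HB.instance Definition _ := GRing.Zmodule.on quomod.
HB.instance Definition _ := ZmodQuotient.on quomod.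

Definition quomod_scale (a : R) (x : quomod) : quomod :=
  \pi_quomod (a *: repr x).

Fact pi_add u v : \pi_quomod (u + v) = \pi_quomod u + \pi_quomod v.
Proof. exact: Quotient.pi_add. Qed.

Fact pi_scale a u : \pi_quomod (a *: u) = quomod_scale a (\pi_quomod u).
Proof.
apply/eqP; rewrite -Quotient.idealrBE -scalerBr rpredZ //.
by rewrite Quotient.idealrBE reprK.
Qed.

Fact pi_surj (x : quomod) : exists u, x = \pi_quomod u.
Proof. by exists (repr x); rewrite reprK. Qed.

Fact quomod_scaleA a b x :
  quomod_scale a (quomod_scale b x) = quomod_scale (a * b) x.
Proof.
by have [u ->] := pi_surj x; rewrite -(pi_scale b) -pi_scale scalerA pi_scale.
Qed.
Fact quomod_scale1 : left_id 1 quomod_scale.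
Proof. by move=> x; have [u ->] := pi_surj x; rewrite -pi_scale scale1r. Qed.
Fact quomod_scaleDr : right_distributive quomod_scale +%R.
Proof.
move=> a x y; have [u ->] := pi_surj x; have [v ->] := pi_surj y.
by rewrite -(pi_add u) -(pi_scale a u) -(pi_scale a v) -pi_add -pi_scale scalerDr.
Qed.
Fact quomod_scaleDl x : {morph quomod_scale^~ x : a b / a + b}.
Proof.
move=> a b; have [u ->] := pi_surj x.
by rewrite -(pi_scale a u) -(pi_scale b u) -pi_add -pi_scale scalerDl.
Qed.
HB.instance Definition _ := GRing.Zmodule_isLmodule.Build R quomod
  quomod_scaleA quomod_scale1 quomod_scaleDr quomod_scaleDl.

Definition quomod_pi (v : V) : quomod := \pi_quomod v.
Fact quomod_pi_linear : linear quomod_pi.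
Proof. by move=> a u v; rewrite /quomod_pi pi_add pi_scale. Qed.
HB.instance Definition _ :=
  GRing.isLinear.Build R V quomod _ quomod_pi quomod_pi_linear.

End SubQuotient.

Definition span_set (V : lmodType R) (G : set V) : set V :=
  [set v | forall N : submodule V, G `<=` smod_set N -> smod_set N v].
Fact span_0 (V : lmodType R) (G : set V) : span_set G 0.
Proof. by move=> N _; apply: smod_0. Qed.
Fact span_lin (V : lmodType R) (G : set V) a u v :
  span_set G u -> span_set G v -> span_set G (a *: u + v).
Proof. by move=> Gu Gv N GN; apply: smod_lin; [apply: Gu|apply: Gv]. Qed.
Definition span V G : submodule V := Submodule (@span_0 V G) (@span_lin V G).

Section Product.
Variables (I : Type) (V : I -> lmodType R).

Definition dprod : Type := forall i, V i.
HB.instance Definition _ := gen_eqMixin dprod.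
HB.instance Definition _ := gen_choiceMixin dprod.

Implicit Types x y z : dprod.
Definition dprod_zero : dprod := fun=> 0.
Definition dprod_opp x : dprod := fun i => - x i.
Definition dprod_add x y : dprod := fun i => x i + y i.
Definition dprod_scale (a : R) x : dprod := fun i => a *: x i.

Fact dprod_addA : associative dprod_add.
Proof. by move=> *; apply: functional_extensionality_dep => i; apply: addrA. Qed.
Fact dprod_addC : commutative dprod_add.
Proof. by move=> *; apply: functional_extensionality_dep => i; apply: addrC. Qed.
Fact dprod_add0 : left_id dprod_zero dprod_add.
Proof. by move=> *; apply: functional_extensionality_dep => i; apply: add0r. Qed.
Fact dprod_addN : left_inverse dprod_zero dprod_opp dprod_add.
Proof. by move=> *; apply: functional_extensionality_dep => i; apply: addNr. Qed.
HB.instance Definition _ :=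
  GRing.isZmodule.Build dprod dprod_addA dprod_addC dprod_add0 dprod_addN.

Fact dprod_scaleA a b x :
  dprod_scale a (dprod_scale b x) = dprod_scale (a * b) x.
Proof. by apply: functional_extensionality_dep => i; apply: scalerA. Qed.
Fact dprod_scale1 : left_id 1 dprod_scale.
Proof. by move=> *; apply: functional_extensionality_dep => i; apply: scale1r. Qed.
Fact dprod_scaleDr : right_distributive dprod_scale +%R.
Proof. by move=> *; apply: functional_extensionality_dep => i; apply: scalerDr. Qed.
Fact dprod_scaleDl x : {morph dprod_scale^~ x : a b / a + b}.
Proof. by move=> *; apply: functional_extensionality_dep => i; apply: scalerDl. Qed.
HB.instance Definition _ := GRing.Zmodule_isLmodule.Build R dprod
  dprod_scaleA dprod_scale1 dprod_scaleDr dprod_scaleDl.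

Definition dsum_set : set dprod := [set x | finite_set [set i | x i <> 0]].
Fact dsum_0 : dsum_set 0.
Proof. by apply: (sub_finite_set _ (finite_set0 I)) => i /=. Qed.
Fact dsum_lin a u v : dsum_set u -> dsum_set v -> dsum_set (a *: u + v).
Proof.
move=> fu fv; have fuv : finite_set ([set i | u i <> 0] `|` [set i | v i <> 0]).
  by rewrite finite_setU.
apply: sub_finite_set fuv => i /= uvi.
have [ui|ui] := pselect (u i = 0); last by left.
right=> vi; apply: uvi; rewrite -[LHS]/(a *: u i + v i).
by rewrite ui vi scaler0 addr0.
Qed.
Definition dsum_sub : submodule dprod := Submodule dsum_0 dsum_lin.

Definition dsum := submod dsum_sub.
HB.instance Definition _ := GRing.Lmodule.on dsum.

Definition single_fun (i : I) (v : V i) : dprod := fun j =>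
  if pselect (i = j) is left e then eq_rect i V v j e else 0.

Fact single_fun_dsum i (v : V i) : single_fun v \in smod_pred dsum_sub.
Proof.
apply/asboolP; apply: (sub_finite_set _ (finite_set1 i)) => j /=.
by rewrite /single_fun; case: pselect => [e _|] //; rewrite e.
Qed.

Definition single i (v : V i) : dsum :=
  exist (fun x => x \in smod_pred dsum_sub) (single_fun v) (single_fun_dsum v).

Fact single_linear i : linear (@single i).
Proof.
move=> a u v; apply/val_inj/functional_extensionality_dep => j /=.
rewrite -[RHS]/(a *: single_fun u j + single_fun v j) /single_fun.
by case: pselect => [e|_]; [case: _ / e|rewrite scaler0 addr0].
Qed.
HB.instance Definition _ i := GRing.isLinear.Build R (V i) dsum _ _ (@single_linear i).

End Product.

(* colim_j lim_i E i j over a filtering poset I, for a system whose transition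
   maps are T i j k l : E i j -> E k l for i <= k and j <= l; it is meant to be
   applied to E i j = F(j) / F(i).  Only the E i j with i <= j matter. *)
Section Limits.
Variables (d : Order.disp_t) (I : porderType d) (E : I -> I -> lmodType R).
Variable T : forall i j k l, {linear E i j -> E k l}.

(* Elements of lim_(i <= j) E i j: compatible families, extended by 0. *)
Definition lim_set j : set (dprod (E^~ j)) :=
  [set x | (forall i, ~~ (i <= j)%O -> x i = 0) /\
           (forall i k, (i <= k)%O -> (k <= j)%O -> T i j k j (x i) = x k)].
Fact lim_0 j : lim_set (0 : dprod (E^~ j)).
Proof. by split=> // i k _ _; apply: linear0. Qed.
Fact lim_lin j a (u v : dprod (E^~ j)) :
  lim_set u -> lim_set v -> lim_set (a *: u + v).
Proof.
move=> [u0 uT] [v0 vT]; split=> [i ij|i k ik kj].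
  by rewrite -[LHS]/(a *: u i + v i) u0 // v0 // scaler0 addr0.
rewrite -[RHS]/(a *: u k + v k) -(uT i) // -(vT i) //.
by rewrite -[X in T _ _ _ _ X]/(a *: u i + v i) linearP.
Qed.
Definition lim_sub j : submodule (dprod (E^~ j)) :=
  Submodule (@lim_0 j) (@lim_lin j).

Definition limmod j := submod (lim_sub j).
HB.instance Definition _ j := GRing.Lmodule.on (limmod j).

Definition lim_proj i j (x : limmod j) : E i j := val x i.
Fact lim_proj_linear i j : linear (@lim_proj i j).
Proof. by []. Qed.
HB.instance Definition _ i j :=
  GRing.isLinear.Build R (limmod j) (E i j) _ _ (@lim_proj_linear i j).

(* x' is the image of x under lim_i E i j -> lim_i E i j' induced by the
   transition maps (the index set i <= j is coinitial in i <= j'). *)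
Definition lim_trans j j' (x : limmod j) (x' : limmod j') : Prop :=
  forall i k, (i <= j)%O -> (k <= j')%O -> (i <= k)%O ->
    T i j k j' (lim_proj i x) = lim_proj k x'.

Definition colim_rel : set (dsum limmod) :=
  [set z | exists j j' (x : limmod j) (x' : limmod j'),
     [/\ (j <= j')%O, lim_trans x x' & z = single x - single x']].

Definition colimmod := quomod (span colim_rel).
HB.instance Definition _ := GRing.Lmodule.on colimmod.

Definition colim_inj j : limmod j -> colimmod :=
  @quomod_pi (dsum limmod) (span colim_rel) \o @single I limmod j.
HB.instance Definition _ j := GRing.Linear.on (@colim_inj j).

End Limits.
End Modules.

Section Characters.
Variable R : comPzRingType.

Definition rat_int : {pred rat} := fun x => x \is a Num.int.
Fact rat_int_closed : zmod_closed rat_int.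
Proof. by split=> [|x y]; [apply: Num.Theory.int_num0|apply: rpredB]. Qed.
HB.instance Definition _ := GRing.isZmodClosed.Build rat rat_int rat_int_closed.

(* Q/Z *)
Definition ratz : zmodType := {quot rat_int}.

Variable A : lmodType R.

Definition character := {additive A -> ratz}.
HB.instance Definition _ := gen_eqMixin character.
HB.instance Definition _ := gen_choiceMixin character.

Fact character_ext (f g : character) : f =1 g -> f = g.
Proof.
case: f g => f [[f0]] [g [[g0]]] /= /funext fg; case: _ / fg g0 => g0.
by rewrite (Prop_irrelevance f0 g0).
Qed.

Implicit Types f g : character.
Definition character_zero : character := \0.
Definition character_opp f : character := \- f.
Definition character_add f g : character := f \+ g.

Fact character_addA : associative character_add.
Proof. by move=> f g h; apply: character_ext => x; apply: addrA. Qed.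
Fact character_addC : commutative character_add.
Proof. by move=> f g; apply: character_ext => x; apply: addrC. Qed.
Fact character_add0 : left_id character_zero character_add.
Proof. by move=> f; apply: character_ext => x; apply: add0r. Qed.
Fact character_addN : left_inverse character_zero character_opp character_add.
Proof. by move=> f; apply: character_ext => x; apply: addNr. Qed.
HB.instance Definition _ := GRing.isZmodule.Build character
  character_addA character_addC character_add0 character_addN.

(* (a f)(x) = f(a x) *)
Definition character_scale (a : R) f : character := f \o ( *:%R a).

Fact character_scaleA a b f :
  character_scale a (character_scale b f) = character_scale (a * b) f.
Proof. by apply: character_ext => x /=; rewrite scalerA mulrC. Qed.
Fact character_scale1 : left_id 1 character_scale.
Proof. by move=> f; apply: character_ext => x /=; rewrite scale1r. Qed.
Fact character_scaleDr : right_distributive character_scale +%R.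
Proof. by move=> a f g; apply: character_ext. Qed.
Fact character_scaleDl f : {morph character_scale^~ f : a b / a + b}.
Proof.
by move=> a b; apply: character_ext => x; rewrite -[LHS]/(f ((a + b) *: x)) scalerDl raddfD.
Qed.
HB.instance Definition _ := GRing.Zmodule_isLmodule.Build R character
  character_scaleA character_scale1 character_scaleDr character_scaleDl.

End Characters.

Section CharacterMaps.
Variable R : comPzRingType.

Definition char_pull (A B : lmodType R) (f : {linear A -> B}) (g : character B) :
  character A := g \o f.
Fact char_pull_linear (A B : lmodType R) (f : {linear A -> B}) :
  linear (char_pull f).
Proof.
move=> a g h; apply: character_ext => x.
by rewrite -[LHS]/(g (a *: f x) + h (f x)) -linearZ.
Qed.
HB.instance Definition _ (A B : lmodType R) (f : {linear A -> B}) :=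
  GRing.isLinear.Build R (character B) (character A) _ _ (char_pull_linear f).

Definition char_ev_fun (A : lmodType R) (x : A) (g : character A) : ratz := g x.
Fact char_ev_additive (A : lmodType R) (x : A) : zmod_morphism (char_ev_fun x).
Proof. by []. Qed.
HB.instance Definition _ (A : lmodType R) (x : A) :=
  GRing.isZmodMorphism.Build (character A) ratz _ (char_ev_additive x).
Definition char_ev (A : lmodType R) (x : A) : character (character A) :=
  char_ev_fun x.
Fact char_ev_linear (A : lmodType R) : linear (@char_ev A).
Proof.
move=> a x y; apply: character_ext => g.
by rewrite -[LHS]/(g (a *: x + y)) raddfD.
Qed.
HB.instance Definition _ (A : lmodType R) :=
  GRing.isLinear.Build R A (character (character A)) _ _ (@char_ev_linear A).

End CharacterMaps.

Section Filtered.
Variable R : comPzRingType.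

(* Objects with an underlying module, and arrows with an underlying linear map.
   The categories A_n are carved out of the levels below by the predicates
   [isobj] and [ismor]; an arrow here carries in addition a choice of arrows
   between the subquotients, which is what the limit functors act on. *)
Record level := Level {
  ob : Type;
  car : ob -> lmodType R;
  arr : ob -> ob -> Type;
  amap : forall X Y, arr X Y -> {linear car X -> car Y}
}.

Definition level0 : level :=
  @Level (lmodType R) id (fun A B => {linear A -> B}) (fun _ _ f => f).

(* A filtered module, given by a representative F of its class of filtrations.
   F(i) is [stp i], embedded in [tot] by [inc i], and F(j) / F(i) is [quo i j]
   with quotient map [prj i j]; [trn i j k l] is the natural map
   F(j) / F(i) -> F(l) / F(k).  The values at pairs not satisfying i <= j are
   irrelevant. *)
Record fmod (C : level) := FMod {
  tot : lmodType R;
  dsp : Order.disp_t;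
  idx : porderType dsp;
  stp : idx -> lmodType R;
  inc : forall i, {linear stp i -> tot};
  quo : idx -> idx -> ob C;
  prj : forall i j, {linear stp j -> car (quo i j)};
  trn : forall i j k l, arr (quo i j) (quo k l)
}.

Arguments stp {C} X i : rename.
Arguments inc {C} X i : rename.
Arguments quo {C} X i j : rename.
Arguments prj {C} X i j : rename.
Arguments trn {C} X i j k l : rename.

(* [sarr i i' j j'] is a set of arrows F(i') / F(i) -> G(j') / G(j) induced by
   the underlying map. *)
Record farr (C : level) (X Y : fmod C) := FArr {
  fmap : {linear tot X -> tot Y};
  sarr : forall i i' j j', set (arr (quo X i i') (quo Y j j'))
}.

Arguments sarr {C X Y} h i i' j j' _ : rename.

Definition filtered (C : level) : level := @Level (fmod C) (@tot C) (@farr C) (@fmap C).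

Fixpoint lvl (n : nat) : level :=
  if n is m.+1 then filtered (lvl m) else level0.

(* f(F(i)) is contained in G(j), f(F(i')) in G(j'), and g is the induced map
   F(i') / F(i) -> G(j') / G(j) *)
Definition induced (C : level) (X Y : fmod C) (f : tot X -> tot Y) i i' j j'
    (g : car (quo X i i') -> car (quo Y j j')) : Prop :=
  (forall x : stp X i, exists y : stp Y j, f (inc X i x) = inc Y j y) /\
  (forall x : stp X i', exists y : stp Y j',
     f (inc X i' x) = inc Y j' y /\ g (prj X i i' x) = prj Y j j' y).

(* morphisms of A_n *)
Fixpoint ismor (n : nat) :
    forall X Y : ob (lvl n), {linear car X -> car Y} -> Prop :=
  match n with
  | 0 => fun _ _ _ => True
  | m.+1 => fun (X Y : fmod (lvl m)) (f : {linear tot X -> tot Y}) =>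
      forall (i : idx X) (j : idx Y), exists i0 j0,
      [/\ (i0 <= i)%O, (j <= j0)%O &
        forall i' j', (i' <= i0)%O -> (j0 <= j')%O ->
        exists g : {linear car (quo X i' i) -> car (quo Y j j')},
          induced f g /\ ismor g]
  end.

(* The arrow with underlying map f carrying all the morphisms induced by f. *)
Fixpoint canon (n : nat) :
    forall X Y : ob (lvl n), {linear car X -> car Y} -> arr X Y :=
  match n with
  | 0 => fun _ _ f => f
  | m.+1 => fun (X Y : fmod (lvl m)) (f : {linear tot X -> tot Y}) =>
      FArr f (fun i i' j j' =>
        [set h | exists g : {linear car (quo X i i') -> car (quo Y j j')},
           [/\ induced f g, ismor g & h = canon g]])
  end.

Definition filtering d (I : porderType d) : Prop := forall i j : I,
  (exists k, (k <= i)%O /\ (k <= j)%O) /\ (exists k, (i <= k)%O /\ (j <= k)%O).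

Record is_filtration (C : level) (X : fmod C) : Prop := IsFiltration {
  idx_filtering : filtering (idx X);
  idx_countable : countable [set: idx X];
  inc_inj : forall i, injective (inc X i);
  inc_mono : forall i j, (i <= j)%O -> range (inc X i) `<=` range (inc X j);
  filt_cap : \bigcap_i range (inc X i) = [set 0];
  filt_cup : \bigcup_i range (inc X i) = setT;
  prj_surj : forall i j, (i <= j)%O -> set_surj setT setT (prj X i j);
  prj_ker : forall i j, (i <= j)%O -> forall x : stp X j,
    prj X i j x = 0 <-> range (inc X i) (inc X j x)
}.

(* objects of A_n.  As prj is surjective, t is the natural map; trn = canon t
   says that the arrow trn carries no information beyond t. *)
Fixpoint isobj (n : nat) : ob (lvl n) -> Prop :=
  match n with
  | 0 => fun A : lmodType R => finite_set [set: A]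
  | m.+1 => fun X : fmod (lvl m) =>
      [/\ is_filtration X,
          forall i j : idx X, (i <= j)%O -> isobj (quo X i j) &
          forall i j k l : idx X,
            (i <= j)%O -> (k <= l)%O -> (i <= k)%O -> (j <= l)%O ->
            let t := amap (trn X i j k l) in
            [/\ forall (x : stp X j) (y : stp X l),
                  inc X j x = inc X l y -> t (prj X i j x) = prj X k l y,
                ismor t & trn X i j k l = canon t]]
  end.

Section Categorical.
Variable n : nat.
Implicit Types X Y Z W : ob (lvl n).

Definition is_iso X Y (f : {linear car X -> car Y}) : Prop :=
  ismor f /\ exists g : {linear car Y -> car X}, [/\ ismor g, cancel f g & cancel g f].

Definition is_kernel X Y Z (a : {linear car X -> car Y})
    (b : {linear car Y -> car Z}) : Prop :=
  [/\ ismor a, forall x, b (a x) = 0 &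
    forall W (f : {linear car W -> car Y}), isobj W -> ismor f ->
      (forall w, b (f w) = 0) ->
      exists g : {linear car W -> car X}, [/\ ismor g, a \o g =1 f &
        forall g' : {linear car W -> car X}, ismor g' -> a \o g' =1 f -> g' =1 g]].

Definition is_cokernel X Y Z (a : {linear car X -> car Y})
    (b : {linear car Y -> car Z}) : Prop :=
  [/\ ismor b, forall x, b (a x) = 0 &
    forall W (f : {linear car Y -> car W}), isobj W -> ismor f ->
      (forall x, f (a x) = 0) ->
      exists g : {linear car Z -> car W}, [/\ ismor g, g \o b =1 f &
        forall g' : {linear car Z -> car W}, ismor g' -> g' \o b =1 f -> g' =1 g]].

(* 0 -> X -> Y -> Z -> 0 is exact in A_n *)
Definition exact_seq X Y Z (a : {linear car X -> car Y})
    (b : {linear car Y -> car Z}) : Prop := is_kernel a b /\ is_cokernel a b.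

End Categorical.

(* strong objects, i.e. objects of S_n *)
Fixpoint strong (n : nat) : ob (lvl n) -> Prop :=
  match n with
  | 0 => @isobj 0
  | m.+1 => fun X : fmod (lvl m) =>
      [/\ @isobj m.+1 X,
          forall i j : idx X, (i <= j)%O -> strong (quo X i j) &
          forall i j k : idx X, (i <= j)%O -> (j <= k)%O ->
            exact_seq (amap (trn X i j i k)) (amap (trn X i k j k))]
  end.

(* The filtered module colim_j lim_i E i j attached to a system E with
   transition arrows T: its steps are the lim_i E i j, and E i j is the
   subquotient in position (i, j). *)
Definition lim_fmod (C : level) d (I : porderType d) (E : I -> I -> ob C)
    (T : forall i j k l, arr (E i j) (E k l)) : fmod C :=
  let t i j k l := amap (T i j k l) in
  @FMod C (colimmod t) d I (limmod t) (@colim_inj _ _ _ _ t) E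
    (@lim_proj _ _ _ _ t) T.

(* The map on colim lim induced by a family S of arrows between the
   subquotients: the class of (x_i)_(i <= j) is sent to the class of any
   (y_k)_(k <= j') such that each y_k is the image of some x_i under an arrow
   of S. *)
Definition lim_map (C : level) (X Y : fmod C)
    (S : forall i i' j j', set (arr (quo X i i') (quo Y j j'))) :
    {linear tot X -> tot Y} :=
  the_linear [set g | forall j (x : stp X j) j' (y : stp Y j'),
    (forall k, (k <= j')%O -> exists i (f : arr (quo X i j) (quo Y k j')),
       [/\ (i <= j)%O, S i j k j' f & prj Y k j' y = amap f (prj X i j x)]) ->
    g (inc X j x) = inc Y j' y].

(* The map tot X -> tot Y which is the limit of maps e i j : F(j)/F(i) -> E i j,
   for Y built from the E i j by [lim_fmod] *)
Definition lim_unit (C : level) (X Y : fmod C) (c : idx X -> idx Y)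
    (e : forall i j, {linear car (quo X i j) -> car (quo Y (c i) (c j))}) :
    {linear tot X -> tot Y} :=
  the_linear [set g | forall j (x : stp X j) (y : stp Y (c j)),
    (forall i, (i <= j)%O -> prj Y (c i) (c j) y = e i j (prj X i j x)) ->
    g (inc X j x) = inc Y (c j) y].

Record functor (C : level) := Functor {
  fob : ob C -> ob C;
  farrow : forall X Y, arr X Y -> arr (fob X) (fob Y)
}.
Record cofunctor (C : level) := Cofunctor {
  cob : ob C -> ob C;
  carrow : forall X Y, arr X Y -> arr (cob Y) (cob X)
}.

Definition compl_step (C : level) (K : functor C) : functor (filtered C) :=
  let o (X : fmod C) := lim_fmod (E := fun i j : idx X => fob K (quo X i j))
                          (fun i j k l => farrow K (trn X i j k l)) in
  @Functor (filtered C) o (fun X Y h =>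
    let S i i' j j' := farrow K (X := quo X i i') (Y := quo Y j j')
                         @` sarr h i i' j j' in
    @FArr C (o X) (o Y) (lim_map (X := o X) (Y := o Y) S) S).

Fixpoint completion (n : nat) : functor (lvl n) :=
  match n with
  | 0 => @Functor level0 id (fun _ _ f => f)
  | m.+1 => compl_step (completion m)
  end.

(* The dual is indexed by the opposite order: its subquotient in position
   (j, i) is the dual of F(j) / F(i). *)
Definition dual_step (C : level) (K : cofunctor C) : cofunctor (filtered C) :=
  let o (X : fmod C) :=
    lim_fmod (I := (idx X)^d%O) (E := fun j i => cob K (quo X i j))
      (fun j i l k => carrow K (trn X k l i j)) in
  @Cofunctor (filtered C) o (fun X Y h =>
    let S j' j i' i := carrow K (X := quo X i i') (Y := quo Y j j')
                         @` sarr h i i' j j' in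
    @FArr C (o Y) (o X) (lim_map (X := o Y) (Y := o X) S) S).

Fixpoint dual (n : nat) : cofunctor (lvl n) :=
  match n with
  | 0 => @Cofunctor level0 (fun A => character A) (fun _ _ f => char_pull f)
  | m.+1 => dual_step (dual m)
  end.

Definition bar n (X : ob (lvl n)) : ob (lvl n) := fob (completion n) X.
Definition hat n (X : ob (lvl n)) : ob (lvl n) := cob (dual n) X.

Definition bar_map n (X Y : ob (lvl n)) (f : {linear car X -> car Y}) :
  {linear car (bar X) -> car (bar Y)} := amap (farrow (completion n) (canon f)).
Definition hathat_map n (X Y : ob (lvl n)) (f : {linear car X -> car Y}) :
    {linear car (hat (hat X)) -> car (hat (hat Y))} :=
  amap (carrow (dual n) (carrow (dual n) (canon f))).

Fixpoint natinj (n : nat) : forall X : ob (lvl n), {linear car X -> car (bar X)} :=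
  match n with
  | 0 => fun A => idfun
  | m.+1 => fun X : fmod (lvl m) =>
      lim_unit (X := X) (Y := @bar m.+1 X) (c := id) (fun i j => natinj (quo X i j))
  end.

Fixpoint delta (n : nat) :
    forall X : ob (lvl n), {linear car X -> car (hat (hat X))} :=
  match n with
  | 0 => fun A => @char_ev R A
  | m.+1 => fun X : fmod (lvl m) =>
      lim_unit (X := X) (Y := @hat m.+1 (@hat m.+1 X)) (c := id)
        (fun i j => delta (quo X i j))
  end.

Definition complete n (X : ob (lvl n)) : Prop := is_iso (natinj X).

End Filtered.

Arguments ismor {R n X Y} f.
Arguments canon {R n X Y} f.
Arguments isobj {R n} X.
Arguments strong {R n} X.
Arguments natinj {R n} X.
Arguments delta {R n} X.
Arguments bar {R n} X.
Arguments hat {R n} X.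
Arguments bar_map {R n X Y} f.
Arguments hathat_map {R n X Y} f.
Arguments is_iso {R n X Y} f.
Arguments complete {R n} X.
Arguments stp {R C} X i : rename.
Arguments inc {R C} X i : rename.
Arguments quo {R C} X i j : rename.
Arguments prj {R C} X i j : rename.
Arguments trn {R C} X i j k l : rename.
Arguments sarr {R C X Y} h i i' j j' _ : rename.

(* Main.v *)
Require Import Defs.
From HB Require Import structures.
From mathcomp Require Import all_boot all_order all_algebra.
From mathcomp Require Import generic_quotient ring_quotient.
From mathcomp Require Import boolp classical_sets functions cardinality.

(** The completion of a filtered module is colim_j lim_i of the completions of the
    subquotients F(j)/F(i). The dual is colim_i lim_j of their duals, over the opposite
    order, and it depends only on the subquotients and the maps between them. As the
    subquotients of the dual are the duals of the subquotients, the double dual is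
    colim_j lim_i of the double duals of the F(j)/F(i), over the original order. So both
    functors arise from their values on finite modules by iterating one construction
    [ustep] ([bidualU_step]; for the completion this is the definition), and the maps
    natinj and delta are the limits of those one level below.

    The theorem then follows by induction from Pontryagin duality for finite modules
    ([char_ev_inj], [char_ev_surj]): a natural isomorphism between two functors U and V
    on one level induces one between [ustep U] and [ustep V] ([equivalent_step]).

    For this induction the maps of colim_j lim_i determined by maps between subquotients
    have to exist and to be unique. This is done for arbitrary coherent families of maps
    in [family_map], which applies to a morphism of filtered modules because its target
    is strong: strongness provides induced maps F(j)/F(i) -> G(l)/G(k) for fixed j and l
    and all k, with i small ([ismor_induces]). The properties of [ustep U] needed at the
    next level (functoriality, preservation of morphisms, naturality and injectivity of
    the unit) are collected in [regular] and propagated by [regular_step]. That a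
    transformation between two such functors is a morphism is preserved because it
    preserves the filtrations without shifting the index ([ismor_post_level],
    [ismor_pre_level]). *)

Set Implicit Arguments.
Unset Strict Implicit.
Unset Printing Implicit Defensive.

Import Order.TTheory GRing.Theory.
Local Open Scope ring_scope.

Local Notation QZ := Defs.ratz.

(** * Pontryagin duality for finite modules *)

Section RatModInt.

Definition rat_class (x : rat) : QZ := (\pi_QZ x)%qT.

Lemma rat_class_surj (x : QZ) : exists r, x = rat_class r.
Proof. by exists (repr x); rewrite /rat_class reprK. Qed.

Fact rat_class_additive : zmod_morphism rat_class.
Proof. by move=> x y; rewrite /rat_class Quotient.pi_add Quotient.pi_opp. Qed.
HB.instance Definition _ := GRing.isZmodMorphism.Build rat QZ rat_class rat_class_additive.

Lemma rat_class_eq0 r : (rat_class r == 0) = (r \is a Num.int).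
Proof. by rewrite -(raddf0 rat_class) -Quotient.idealrBE subr0. Qed.

Lemma ratz_div (x : QZ) m : (0 < m)%N -> exists y, y *+ m = x.
Proof.
move=> m0; have [r ->] := rat_class_surj x; exists (rat_class (r / m%:R)).
rewrite -raddfMn; congr rat_class.
by rewrite -[LHS]mulr_natr mulfVK // Num.Theory.pnatr_eq0 -lt0n.
Qed.

Definition inv_class (N : nat) : QZ := rat_class N%:R^-1.

Lemma inv_classMn N : (0 < N)%N -> inv_class N *+ N = 0.
Proof.
move=> N0; rewrite -raddfMn; apply/eqP; rewrite rat_class_eq0.
by rewrite -[X in X \is a _]mulr_natr mulVf ?rpred1 // Num.Theory.pnatr_eq0 -lt0n.
Qed.

Lemma inv_class_neq0 N : (1 < N)%N -> inv_class N != 0.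
Proof.
move=> N1; rewrite rat_class_eq0; apply/negP => /Num.Theory.intrP[z zN].
have N0 : (N%:R : rat) != 0 by rewrite Num.Theory.pnatr_eq0 -lt0n ltnW.
have : (z * N%:Z)%:~R = 1%:~R :> rat.
  by rewrite rmorphM /= -zN -pmulrn mulVf.
move=> /intr_inj /(congr1 absz); rewrite abszM => /eqP; rewrite muln_eq1.
by case/andP=> _ /eqP /= NE; rewrite NE in N1.
Qed.

Lemma torsion_inv_class (x : QZ) N : (0 < N)%N -> x *+ N = 0 ->
  exists k : int, x = inv_class N *~ k.
Proof.
move=> N0; have [r ->] := rat_class_surj x => /eqP.
rewrite -raddfMn rat_class_eq0 => /Num.Theory.intrP[z zr]; exists z.
rewrite /inv_class -raddfMz; congr rat_class.
have N0' : (N%:R : rat) != 0 by rewrite Num.Theory.pnatr_eq0 -lt0n.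
by apply: (mulIf N0'); rewrite mulr_natr zr -[_^-1 *~ z]mulrzl mulfVK.
Qed.

End RatModInt.

Lemma mulzfctE (T : Type) (V : zmodType) (f : T -> V) (k : int) x : (f *~ k) x = f x *~ k.
Proof.
by case: k => n; rewrite ?NegzE ?mulrNz -!pmulrn ?opprfctE natmulfctE.
Qed.

Section PartialCharacters.
Variable G : zmodType.
Implicit Types (H : set G) (chi : G -> QZ).

Record is_partial H chi : Prop := IsPartial {
  part0 : H 0;
  partB : forall x y, H x -> H y -> H (x - y);
  part_additive : forall x y, H x -> H y -> chi (x - y) = chi x - chi y
}.

Lemma part_chi0 H chi : is_partial H chi -> chi 0 = 0.
Proof. by move=> [H0 _ /(_ _ _ H0 H0)]; rewrite !subrr. Qed.

Lemma part_mulz H chi x k : is_partial H chi -> H x ->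
  H (x *~ k) /\ chi (x *~ k) = chi x *~ k.
Proof.
move=> pH Hx; have c0 := part_chi0 pH; case: pH => H0 Hsub cB.
have HN y : H y -> H (- y) /\ chi (- y) = - chi y.
  by move=> Hy; rewrite -sub0r; split; [apply: Hsub|rewrite cB // c0 sub0r].
have nat_case n : H (x *+ n) /\ chi (x *+ n) = chi x *+ n.
  elim: n => [|n [Hn cn]]; first by rewrite !mulr0n.
  have [HNx cNx] := HN _ Hx.
  rewrite !mulrSr -[x in _ + x]opprK; split; first exact: Hsub.
  by rewrite cB // cn cNx opprK.
case: k => n; first exact: nat_case.
rewrite NegzE !mulrNz; have [Hn cn] := nat_case n.+1.
by have [HNn ->] := HN _ Hn; rewrite -!pmulrn cn.
Qed.

Lemma part_add H chi x y : is_partial H chi -> H x -> H y ->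
  H (x + y) /\ chi (x + y) = chi x + chi y.
Proof.
move=> pH Hx Hy; have [HNy cNy] := part_mulz (-1) pH Hy; have [_ HB cB] := pH.
rewrite !mulrN1z in HNy cNy.
rewrite -[y in x + y]opprK -[chi y]opprK -cNy -cB //; split=> //; exact: HB.
Qed.

Definition extends_to H chi H' chi' :=
  forall x, H x -> H' x /\ chi' x = chi x.

(** The extension is x |-> chi(x - k g) + k q for any integer k with x - k g in [H]. By
    minimality of [m], two such k differ by a multiple of [m], so that the condition on
    [q] makes the value independent of k. *)
Lemma partial_adjoin H chi g m q : is_partial H chi -> (0 < m)%N -> H (g *+ m) ->
  (forall k, (0 < k)%N -> H (g *+ k) -> (m <= k)%N) -> q *+ m = chi (g *+ m) ->
  exists H' chi', [/\ is_partial H' chi', extends_to H chi H' chi', H' g & chi' g = q].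
Proof.
move=> pH m0 Hgm m_min qm; have [H0 Hsub cB] := pH.
have HgE d : H (g *~ d) -> chi (g *~ d) = q *~ d.
  move=> Hd; have mz : (m%:Z : int) != 0 by rewrite -lt0n.
  have dE := divz_eq d m; set t := (d %/ m)%Z in dE; set r := (d %% m)%Z in dE.
  have [Hmt cmt] := part_mulz t pH Hgm.
  have gmt : g *+ m *~ t = g *~ (t * m%:Z) by rewrite mulrC mulrzA.
  have Hr : H (g *~ r).
    have -> : r = d - t * m%:Z by rewrite {1}dE addrC addKr.
    by rewrite mulrzBr -gmt; apply: Hsub.
  have r0 : r = 0.
    have := modz_ge0 d mz; have := ltz_pmod d (d := m%:Z); rewrite -/r.
    case: r Hr {dE} => // -[//|r] Hr /(_ m0) rm _.
    have := m_min r.+1 isT Hr; rewrite leqNgt.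
    by move: rm; rewrite ltz_nat => ->.
  by rewrite dE r0 addr0 -gmt cmt -qm mulrC mulrzA.
pose H' : set G := [set x | exists k : int, H (x - g *~ k)]%classic.
pose P x y := (exists k : int, H (x - g *~ k)) ->
  exists k : int, H (x - g *~ k) /\ y = chi (x - g *~ k) + q *~ k.
have /(_ _)/cid - c x : exists y, P x y.
  have [[k Hk]|nk] := pselect (exists k : int, H (x - g *~ k)); last by exists 0 => /nk.
  by exists (chi (x - g *~ k) + q *~ k) => _; exists k.
pose chi' x := projT1 (c x).
have chi'E x k : H (x - g *~ k) -> chi' x = chi (x - g *~ k) + q *~ k.
  move=> Hk; rewrite /chi'; case: (c x) => y Py /=.
  have [k' [Hk' ->]] : exists k' : int, H (x - g *~ k') /\ y = chi (x - g *~ k') + q *~ k'.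
    by apply: Py; exists k.
  have kk' : g *~ (k - k') = (x - g *~ k') - (x - g *~ k).
    by rewrite mulrzBr opprB [RHS]addrC addrA subrK.
  have Hkk' : H (g *~ (k - k')) by rewrite kk'; apply: Hsub.
  have E := HgE _ Hkk'; rewrite kk' cB // mulrzBr in E.
  by apply/eqP; rewrite -subr_eq0 opprD addrACA E addrA subrK subrr.
exists H', chi'; split.
- split=> [|x y [k Hk] [l Hl]|x y [k Hk] [l Hl]].
  + by exists 0; rewrite mulr0z subr0.
  + exists (k - l); have -> : x - y - g *~ (k - l) = (x - g *~ k) - (y - g *~ l).
      by rewrite mulrzBr !opprD !opprK addrACA.
    exact: Hsub.
  + have xyE : x - y - g *~ (k - l) = (x - g *~ k) - (y - g *~ l).
      by rewrite mulrzBr !opprD !opprK addrACA.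
    rewrite (chi'E _ _ Hk) (chi'E _ _ Hl) (chi'E _ (k - l)) ?xyE; last exact: Hsub.
    by rewrite cB // mulrzBr opprD addrACA.
- move=> x Hx; have Hx0 : H (x - g *~ 0) by rewrite mulr0z subr0.
  by split; [exists 0|rewrite (chi'E _ _ Hx0) mulr0z subr0 mulr0z addr0].
- by exists 1; rewrite mulr1z subrr.
by rewrite (chi'E _ 1) ?mulr1z ?subrr // (part_chi0 pH) add0r.
Qed.

(** Q/Z is divisible, so a suitable value at each further element exists. *)
Lemma partial_extend H chi (s : seq G) : is_partial H chi ->
  (forall g, g \in s -> exists2 N, (0 < N)%N & g *+ N = 0) ->
  exists H' chi', [/\ is_partial H' chi', extends_to H chi H' chi' &
    forall g, g \in s -> H' g].
Proof.
move=> pH; elim: s => [|g s IH] s_tors.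
  by exists H, chi; split.
have [|H1 [chi1 [pH1 HH1 sH1]]] := IH; first by move=> h hs; apply: s_tors; rewrite inE hs orbT.
have [N N0 gN] := s_tors g (mem_head _ _).
have ex : exists m, (0 < m)%N && `[< H1 (g *+ m) >].
  by exists N; rewrite N0; apply/asboolP; rewrite gN; apply: part0 pH1.
case: (ex_minnP ex) => m /andP[m0 /asboolP Hgm] m_min.
have [q qm] := ratz_div (chi1 (g *+ m)) m0.
have [|H2 [chi2 [pH2 H12 H2g _]]] := partial_adjoin pH1 m0 Hgm _ qm.
  by move=> k k0 /asboolP Hk; apply: m_min; rewrite k0.
exists H2, chi2; split=> // [x /HH1[/H12[H2x ->]]|h] //.
by rewrite inE => /orP[/eqP ->|/sH1/H12[]].
Qed.

End PartialCharacters.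

Section FiniteDuality.
Variables (R : comPzRingType) (A : lmodType R).
Hypothesis finA : finite_set [set: A].

Lemma finite_enum : exists s : seq A, forall a, a \in s.
Proof.
have /finite_seqP[s sA] := finA; exists s => a.
by have : [set: A]%classic a by []; rewrite sA.
Qed.

Lemma finite_exponent : exists2 N, (0 < N)%N & forall a : A, a *+ N = 0.
Proof.
have [s sA] := finite_enum; exists (size s)`!; first exact: fact_gt0.
move=> a; pose f (i : 'I_(size s).+1) := a *+ i.
have : ~~ injectiveb f.
  apply/negP => /injectiveP f_inj.
  have := uniq_leq_size (s1 := codom f) (s2 := s).
  rewrite size_codom card_ord ltnn => H; suff: false by [].
  apply: H => //; exact/injectiveP.
case/injectivePn => i [j ij fij].
wlog lt_ij : i j ij fij / (i < j)%N.
  move=> W; have [lt|lt|/val_inj e] := ltngtP i j; first exact: (W i j).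
    by apply: (W j i) => //; rewrite eq_sym.
  by rewrite e eqxx in ij.
have ji0 : a *+ (j - i) = 0 by rewrite mulrnBr ?(ltnW lt_ij) // -[a *+ j]fij subrr.
have /dvdnP[c ->] : (j - i %| (size s)`!)%N.
  rewrite dvdn_fact // subn_gt0 lt_ij /=.
  by rewrite (leq_trans (leq_subr _ _)) // -ltnS.
by rewrite mulnC mulrnA ji0 mul0rn.
Qed.

Lemma total_character (H : set A) chi : is_partial H chi -> (forall a, H a) ->
  exists chi' : character A, forall a, chi' a = chi a.
Proof.
move=> [_ _ cB] HA.
have chiB : zmod_morphism chi by move=> x y; apply: cB.
pose chi' : {additive A -> QZ} :=
  HB.pack chi (GRing.isZmodMorphism.Build A QZ chi chiB).
by exists chi'.
Qed.

(** Characters separate points: on the subgroup generated by an element of order m > 1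
    there is a character with value the class of 1/m there, and it extends to [A]. *)
Lemma char_ev_inj : injective (@char_ev R A).
Proof.
apply: raddf_inj => a a0; apply/eqP/negP => /negP an0.
have [s sA] := finite_enum; have [N N0 NA] := finite_exponent.
have ex : exists m, (0 < m)%N && (a *+ m == 0) by exists N; rewrite N0 NA eqxx.
case: (ex_minnP ex) => m /andP[m0 /eqP am] m_min.
have m1 : (1 < m)%N.
  case: m m0 am {m_min} => [|[|m]] // _ am.
  by rewrite -[a]mulr1n am eqxx in an0.
have p0 : is_partial [set 0 : A]%classic (fun=> 0).
  by split=> //= [x y -> ->|x y _ _]; rewrite subrr.
have [|H [chi [pH _ Ha chia]]] :=
    partial_adjoin p0 m0 (g := a) (q := inv_class m) am _ (inv_classMn m0).
  by move=> k k0 /= ak; apply: m_min; rewrite k0 ak eqxx.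
have [|H' [chi' [pH' HH' H's]]] := partial_extend (s := s) pH.
  by move=> g _; exists N.
have [psi psiE] := total_character pH' (fun x => H's x (sA x)).
have := inv_class_neq0 m1; rewrite -chia -(HH' a Ha).2 -psiE.
by rewrite -[psi a]/(char_ev a psi) a0 eqxx.
Qed.

(** With N an exponent of [A], let d_a be the function A -> Q/Z supported at a with value
    the class of 1/N. Every character of [A] is an integer combination of the d_a. Extend
    [phi] to a character of a group of functions containing the d_a: it is killed by N
    on d_a, so its value there is l_a / N with l_a an integer, and [phi] is evaluation at
    the sum of the l_a a. *)
Lemma char_ev_surj (phi : character (character A)) : exists a, char_ev a = phi.
Proof.
have [s sA] := finite_enum; have [N N0 NA] := finite_exponent.
pose t := undup s; have ut : uniq t := undup_uniq s.
have tA a : a \in t by rewrite mem_undup.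
pose H : set (A -> QZ) := [set f : A -> QZ | exists chi : character A, f = (chi : A -> QZ)]%classic.
pose P (f : A -> QZ) y := forall chi : character A, f = (chi : A -> QZ) -> y = phi chi.
have /(_ _)/cid - c f : exists y, P f y.
  have [[chi fchi]|nf] := pselect (exists chi : character A, f = (chi : A -> QZ)).
    by exists (phi chi) => chi' e; congr (phi _); apply: character_ext => x; rewrite -fchi e.
  by exists 0 => chi e; case: nf; exists chi.
pose Phi f := projT1 (c f).
have PhiE (chi : character A) : Phi chi = phi chi by rewrite /Phi; case: (c _) => y /=; apply.
have pH : is_partial H Phi.
  split=> [|x y [f ->] [g ->]|x y [f ->] [g ->]]; first by exists 0.
    by exists (f - g).
  have -> : (f : A -> QZ) - (g : A -> QZ) = (f - g : character A) by [].
  by rewrite !PhiE raddfB.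
pose d a : A -> QZ := fun x => if x == a then inv_class N else 0.
have dN a : d a *+ N = 0.
  apply: funext => x; rewrite natmulfctE /d.
  by case: ifP => _; [apply: inv_classMn|apply: mul0rn].
have [|H' [Psi [pH' HH' H'd]]] := partial_extend (s := [seq d a | a <- t]) pH.
  by move=> _ /mapP[a _ ->]; exists N.
have H'da a : H' (d a) by apply/H'd/map_f.
have l_ex a : exists l : int, Psi (d a) = inv_class N *~ l.
  apply: (torsion_inv_class N0); have [_] := part_mulz N%:Z pH' (H'da a).
  by rewrite -!pmulrn dN (part_chi0 pH') => <-.
have /(_ _)/cid - l := l_ex.
exists (\sum_(a <- t) a *~ projT1 (l a)); apply: character_ext => chi.
have k_ex a : exists k : int, chi a = inv_class N *~ k.
  by apply: (torsion_inv_class N0); rewrite -raddfMn NA raddf0.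
have /(_ _)/cid - k := k_ex.
have chiE : (chi : A -> QZ) = \sum_(a <- t) d a *~ projT1 (k a).
  apply: funext => x; rewrite fct_sumE (bigD1_seq x) //= big1 => [|a ax].
    by rewrite addr0 mulzfctE /d eqxx; case: (k x).
  by rewrite mulzfctE /d eq_sym (negbTE ax) mul0rz.
have PsiE r : H' (\sum_(a <- r) d a *~ projT1 (k a)) /\
    Psi (\sum_(a <- r) d a *~ projT1 (k a)) = \sum_(a <- r) Psi (d a) *~ projT1 (k a).
  elim: r => [|a r [Hr Pr]].
    by rewrite !big_nil (part_chi0 pH'); split=> //; apply: part0 pH'.
  have [Ha Pa] := part_mulz (projT1 (k a)) pH' (H'da a).
  by rewrite !big_cons -Pr -Pa; apply: part_add pH' Ha Hr.
rewrite -PhiE -(HH' _ _).2; last by exists chi.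
rewrite chiE (PsiE t).2 /char_ev /= /char_ev_fun raddf_sum; apply: eq_bigr => a _.
rewrite raddfMz; case: (k a) => z /= ->; case: (l a) => w /= ->.
by rewrite -!mulrzA mulrC.
Qed.

End FiniteDuality.

(** * Filtered colimits of projective limits *)

Section ColimLim.
Variables (R : comPzRingType) (d : Order.disp_t) (I : porderType d).
Variables (E : I -> I -> lmodType R) (T : forall i j k l, {linear E i j -> E k l}).
Hypothesis filtI : filtering I.
Hypothesis T_comp : forall i j k l m p, (i <= j)%O -> (k <= l)%O -> (m <= p)%O ->
  (i <= k)%O -> (j <= l)%O -> (k <= m)%O -> (l <= p)%O ->
  forall e, T k l m p (T i j k l e) = T i j m p e.

Lemma lower_bound (i j : I) : exists k, (k <= i)%O /\ (k <= j)%O.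
Proof. by case: (filtI i j). Qed.

Lemma upper_bound (i j : I) : exists k, (i <= k)%O /\ (j <= k)%O.
Proof. by case: (filtI i j). Qed.

Definition lbound (i j : I) : I := projT1 (cid (lower_bound i j)).

Lemma lbound_l i j : (lbound i j <= i)%O.
Proof. by rewrite /lbound; case: cid => k []. Qed.

Lemma lbound_r i j : (lbound i j <= j)%O.
Proof. by rewrite /lbound; case: cid => k []. Qed.

Lemma limmod_off j (x : limmod T j) i : ~~ (i <= j)%O -> lim_proj i x = 0.
Proof. by case: x => x /= xl ij; have /asboolP [x0 _] := xl; apply: x0. Qed.

Lemma limmod_tr j (x : limmod T j) i k : (i <= k)%O -> (k <= j)%O ->
  T i j k j (lim_proj i x) = lim_proj k x.
Proof. by case: x => x /= xl ij; have /asboolP [_ xT] := xl; apply: xT. Qed.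

Lemma limmod_ext j (x y : limmod T j) :
  (forall i, (i <= j)%O -> lim_proj i x = lim_proj i y) -> x = y.
Proof.
move=> xy; apply/val_inj/functional_extensionality_dep => i.
have [/xy //|ij] := boolP (i <= j)%O.
by rewrite -[LHS]/(lim_proj i x) -[RHS]/(lim_proj i y) !limmod_off.
Qed.

Lemma limmod_lift j (e : forall i, E i j) :
  (forall i k, (i <= k)%O -> (k <= j)%O -> T i j k j (e i) = e k) ->
  exists x : limmod T j, forall i, (i <= j)%O -> lim_proj i x = e i.
Proof.
move=> eT; pose e' : dprod (E^~ j) := fun i => if (i <= j)%O then e i else 0.
have e'l : e' \in smod_pred (lim_sub T j).
  apply/asboolP; split=> [i /negbTE ij|i k ik kj]; rewrite /e' ?ij //.
  by rewrite kj (le_trans ik kj) eT.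
by exists (exist _ e' e'l) => i ij; rewrite /lim_proj /= /e' ij.
Qed.

(** The component at [k] of the image of [x] in lim_i E i J. By [extendE] it does not
    depend on the index below [j] and [k] through which it is computed. *)
Definition extend J k j (x : limmod T j) : E k J :=
  T (lbound j k) j k J (lim_proj (lbound j k) x).

Lemma extendE J k j (x : limmod T j) i : (j <= J)%O -> (k <= J)%O ->
  (i <= j)%O -> (i <= k)%O -> extend J k x = T i j k J (lim_proj i x).
Proof.
move=> jJ kJ ij ik; rewrite /extend; set i' := lbound j k.
have i'j : (i' <= j)%O := lbound_l j k.
have i'k : (i' <= k)%O := lbound_r j k.
have [h [hi hi']] := lower_bound i i'.
rewrite -(limmod_tr x hi ij) -(limmod_tr x hi' i'j) !T_comp //;
  exact: le_trans hi _.
Qed.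

Fact extend_linear J k j : linear (@extend J k j).
Proof. by move=> a x y; rewrite /extend !linearP. Qed.
HB.instance Definition _ J k j :=
  GRing.isLinear.Build R (limmod T j) (E k J) _ _ (@extend_linear J k j).

Lemma extend_tr J k J' k' j (x : limmod T j) : (j <= J)%O -> (k <= J)%O ->
  (J <= J')%O -> (k' <= J')%O -> (k <= k')%O ->
  T k J k' J' (extend J k x) = extend J' k' x.
Proof.
move=> jJ kJ JJ' kJ' kk'; have lj := lbound_l j k; have lk := lbound_r j k.
rewrite {1}/extend T_comp // -extendE //; [exact: le_trans JJ'|exact: le_trans kk'].
Qed.

Lemma extend_limmod j J (x : limmod T j) : (j <= J)%O ->
  exists y : limmod T J, forall k, (k <= J)%O -> lim_proj k y = extend J k x.
Proof.
move=> jJ; apply: limmod_lift => i k ik kJ.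
by apply: extend_tr => //; apply: le_trans kJ.
Qed.

Lemma lim_transP j J (x : limmod T j) (y : limmod T J) : (j <= J)%O ->
  (forall k, (k <= J)%O -> lim_proj k y = extend J k x) <-> lim_trans x y.
Proof.
move=> jJ; split=> [xy i k ij kJ ik|xy k kJ]; first by rewrite xy // (@extendE _ _ _ _ i).
by rewrite (@extendE _ _ _ _ (lbound j k)) ?lbound_l ?lbound_r // xy ?lbound_l ?lbound_r.
Qed.

Lemma quomod_pi_eq0 (V : lmodType R) (N : submodule V) (v : V) :
  quomod_pi N v = 0 <-> smod_set N v.
Proof.
split=> [/eqP|Nv].
  by rewrite -[0](linear0 (quomod_pi N)) -Quotient.idealrBE subr0 => /asboolP.
apply/eqP; rewrite -[0](linear0 (quomod_pi N)) -Quotient.idealrBE subr0.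
exact/asboolP.
Qed.

Lemma colim_inj_trans j J (x : limmod T j) (y : limmod T J) : (j <= J)%O ->
  lim_trans x y -> colim_inj x = colim_inj y.
Proof.
move=> jJ xy; apply/eqP; rewrite -subr_eq0; apply/eqP.
rewrite /colim_inj /= -linearB; apply/quomod_pi_eq0 => N; apply.
by exists j, J, x, y.
Qed.

(** The projection of the direct sum to a summand, as a function of its own so that
    rewriting does not meet the subtype structure. *)
Definition dcomp (z : dsum (limmod T)) j : limmod T j := val z j.

Lemma single_at j (x : limmod T j) : dcomp (single x) j = x.
Proof.
rewrite /dcomp /= /single_fun; case: pselect => // e.
by rewrite (Prop_irrelevance e erefl).
Qed.

Lemma single_off j (x : limmod T j) i : j <> i -> dcomp (single x) i = 0.
Proof. by move=> ji; rewrite /dcomp /= /single_fun; case: pselect. Qed.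

(** For [z] supported in the list [s] of indices below [J], the component at [k] of the
    image of [z] in lim_i E i J. *)
Definition total s J k (z : dsum (limmod T)) : E k J :=
  \sum_(j <- s) extend J k (dcomp z j).

Fact total_linear s J k : linear (@total s J k).
Proof.
move=> a u v; rewrite /total scaler_sumr -big_split /=.
by apply: eq_bigr => j _; rewrite -linearP.
Qed.
HB.instance Definition _ s J k :=
  GRing.isLinear.Build R (dsum (limmod T)) (E k J) _ _ (@total_linear s J k).

Lemma total_single s J k j (x : limmod T j) : uniq s -> j \in s ->
  total s J k (single x) = extend J k x.
Proof.
move=> us js; rewrite /total (bigD1_seq j) //= single_at.
rewrite big1 ?addr0 // => i /eqP ij.
by rewrite single_off ?linear0 // => ji; apply: ij.
Qed.

Lemma total_widen s s' J k (z : dsum (limmod T)) : uniq s -> uniq s' ->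
  {subset s <= s'} -> (forall j, j \notin s -> dcomp z j = 0) ->
  total s' J k z = total s J k z.
Proof.
move=> us us' ss' z0; rewrite /total.
rewrite (bigID (mem s)) /= [X in _ + X]big1 => [|j /z0 ->]; last exact: linear0.
rewrite addr0 -big_filter; apply: perm_big; apply: uniq_perm => //.
  exact: filter_uniq.
by move=> j; rewrite mem_filter andb_idr // => /ss'.
Qed.

(** The elements whose summands add up to zero after transport to a common later
    step. They form a submodule containing the defining relations of the colimit, hence
    every element that is zero in the colimit. *)
Definition vanishing : set (dsum (limmod T)) := [set z | exists s J,
  [/\ uniq s, forall j, j \notin s -> dcomp z j = 0,
      forall j, j \in s -> (j <= J)%O & forall k, (k <= J)%O -> total s J k z = 0]].

Lemma vanishing_mono (z : dsum (limmod T)) s J s' J' : uniq s ->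
  (forall j, j \notin s -> dcomp z j = 0) -> (forall j, j \in s -> (j <= J)%O) ->
  (forall k, (k <= J)%O -> total s J k z = 0) ->
  uniq s' -> {subset s <= s'} -> (J <= J')%O ->
  forall k, (k <= J')%O -> total s' J' k z = 0.
Proof.
move=> us z0 sJ zJ us' ss' JJ' k kJ'; rewrite (total_widen _ _ us) //.
have lJ := lbound_l J k; have lk := lbound_r J k.
rewrite -[RHS](linear0 (T (lbound J k) J k J')) -(zJ _ lJ) /total linear_sum.
by apply: eq_big_seq => j /sJ jJ; rewrite extend_tr.
Qed.

Hypothesis I0 : I.

Fact vanishing_0 : vanishing 0.
Proof. by exists [::], I0; split=> // k _; rewrite /total big_nil. Qed.

Fact vanishing_lin a u v : vanishing u -> vanishing v -> vanishing (a *: u + v).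
Proof.
move=> [s [J [us u0 sJ uJ]]] [s' [J' [us' v0 sJ' vJ']]].
have [K [JK JK']] := upper_bound J J'.
exists (undup (s ++ s')), K; split=> [|j|j|k kK].
- exact: undup_uniq.
- rewrite mem_undup mem_cat negb_or => /andP[js js'].
  by rewrite -[LHS]/(a *: dcomp u j + dcomp v j) u0 // v0 // scaler0 addr0.
- rewrite mem_undup mem_cat => /orP[/sJ jJ|/sJ' jJ'].
    exact: le_trans JK.
  exact: le_trans JK'.
rewrite linearP /= (vanishing_mono us u0 sJ uJ) ?undup_uniq //; last first.
  by move=> j js; rewrite mem_undup mem_cat js.
rewrite (vanishing_mono us' v0 sJ' vJ') ?undup_uniq ?scaler0 ?addr0 //.
by move=> j js; rewrite mem_undup mem_cat js orbT.
Qed.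

Definition vanishing_sub := Submodule vanishing_0 vanishing_lin.

Lemma colim_rel_vanishing : subset (colim_rel (T:=T)) vanishing.
Proof.
move=> z [j [J [x [y [jJ xy ->]]]]].
exists (undup [:: j; J]), J; split=> [|i|i|k kJ].
- exact: undup_uniq.
- rewrite mem_undup !inE negb_or => /andP[/eqP ij /eqP iJ].
  by rewrite -[LHS]/(dcomp (single x) i - dcomp (single y) i) !single_off ?subr0 // => e;
    [apply: iJ|apply: ij].
- by rewrite mem_undup !inE => /orP[] /eqP ->.
have us := undup_uniq [:: j; J].
have [js Js] : j \in undup [:: j; J] /\ J \in undup [:: j; J].
  by rewrite !mem_undup !inE !eqxx orbT.
move: us js Js; set s := undup _ => us js Js.
rewrite linearB /= !total_single //.
have /(lim_transP _ _ jJ) <- // := xy.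
by rewrite (@extendE J k J y k) // limmod_tr // subrr.
Qed.

(** A filtered colimit identifies nothing beyond what becomes equal at a later step. *)
Lemma colim_inj_eq0 j (x : limmod T j) : colim_inj x = 0 ->
  exists J, (j <= J)%O /\ forall k, (k <= J)%O -> extend J k x = 0.
Proof.
move=> /quomod_pi_eq0 /(_ vanishing_sub colim_rel_vanishing) [s [J [us x0 sJ xJ]]].
have [js|/x0] := boolP (j \in s).
  by exists J; split=> [|k kJ]; [apply: sJ|rewrite -(total_single _ _ _ us js) xJ].
by rewrite single_at => ->; exists j; split=> // k kj; rewrite linear0.
Qed.

Lemma colim_cover (z : colimmod T) : exists j (x : limmod T j), z = colim_inj x.
Proof.
have [w ->] := pi_surj z; rewrite -/(quomod_pi _ w).
have [s ws] : exists s : seq I, forall j, j \notin s -> dcomp w j = 0.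
  case: w => w wl; have /asboolP /finite_seqP [s sw] := wl; exists s => j js.
  rewrite /dcomp /=; have [//|wj] := pselect (w j = 0); suff: j \in s by rewrite (negbTE js).
  by have : [set i | w i <> 0]%classic j by []; rewrite sw.
elim: s w ws => [|j s IH] w ws.
  have -> : w = 0 by apply/val_inj/functional_extensionality_dep => i; apply: ws.
  exists I0, 0; transitivity (0 : colimmod T); first exact: linear0.
  by symmetry; apply: linear0.
have [|h [x hx]] := IH (w - single (dcomp w j)).
  move=> i si; rewrite -[LHS]/(dcomp w i - dcomp (single (dcomp w j)) i).
  have [->|/eqP ij] := eqVneq i j; first by rewrite single_at subrr.
  rewrite single_off ?ws ?subr0 //; last by move=> e; apply: ij.
  by rewrite inE negb_or si andbT; apply/eqP.
have [J [jJ hJ]] := upper_bound j h.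
have [y /(lim_transP _ _ hJ) /(colim_inj_trans hJ) xy] := extend_limmod x hJ.
have [y' /(lim_transP _ _ jJ) /(colim_inj_trans jJ) wy'] := extend_limmod (dcomp w j) jJ.
exists J, (y + y'); transitivity (colim_inj y + colim_inj y'); last first.
  by symmetry; apply: linearD.
rewrite -xy -wy' -hx; transitivity (quomod_pi (Defs.span (colim_rel (T:=T)))
  (w - single (dcomp w j) + single (dcomp w j))).
  by rewrite subrK.
exact: linearD.
Qed.

End ColimLim.

(** * Maps determined by their components *)

Section Systems.
Variables (R : comPzRingType) (C : level R).
Implicit Types X Y : fmod C.

Definition tr X i j k l : {linear car (quo X i j) -> car (quo X k l)} :=
  amap (trn X i j k l).
Arguments tr : clear implicits.

(** The properties shared by filtered modules and by the modules colim_j lim_i: an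
    element is a compatible family of components in the subquotients [quo i j], given at
    some step [j] and up to passing to later steps. *)
Record is_system X : Prop := IsSystem {
  sys_filtering : filtering (idx X);
  sys_cover : forall z, exists j (x : stp X j), z = inc X j x;
  sys_sep : forall j (x : stp X j), (forall i, (i <= j)%O -> prj X i j x = 0) -> x = 0;
  sys_prj : forall i j k (x : stp X j), (i <= k)%O -> (k <= j)%O ->
    tr X i j k j (prj X i j x) = prj X k j x;
  sys_id : forall i j, (i <= j)%O -> forall e, tr X i j i j e = e;
  sys_comp : forall i j k l m p, (i <= j)%O -> (k <= l)%O -> (m <= p)%O ->
    (i <= k)%O -> (j <= l)%O -> (k <= m)%O -> (l <= p)%O ->
    forall e, tr X k l m p (tr X i j k l e) = tr X i j m p e;
  sys_extend : forall j j' (x : stp X j), (j <= j')%O -> exists x' : stp X j',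
    inc X j' x' = inc X j x /\
    forall i k, (i <= j)%O -> (k <= j')%O -> (i <= k)%O ->
      tr X i j k j' (prj X i j x) = prj X k j' x';
  sys_zero : forall j (x : stp X j), inc X j x = 0 -> exists j', (j <= j')%O /\
    forall i k, (i <= j)%O -> (k <= j')%O -> (i <= k)%O ->
      tr X i j k j' (prj X i j x) = 0
}.

(** Every compatible family comes from an element, as in a projective limit. *)
Definition is_complete_system X : Prop :=
  forall j (e : forall i, car (quo X i j)),
    (forall i k, (i <= k)%O -> (k <= j)%O -> tr X i j k j (e i) = e k) ->
    exists x : stp X j, forall i, (i <= j)%O -> prj X i j x = e i.

Lemma sys_lower X : is_system X -> forall i j : idx X, exists k, (k <= i)%O /\ (k <= j)%O.
Proof. by move=> /sys_filtering fX i j; case: (fX i j). Qed.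

Lemma sys_upper X : is_system X -> forall i j : idx X, exists k, (i <= k)%O /\ (j <= k)%O.
Proof. by move=> /sys_filtering fX i j; case: (fX i j). Qed.

Definition extends X j J (x : stp X j) (x' : stp X J) : Prop :=
  forall i k, (i <= j)%O -> (k <= J)%O -> (i <= k)%O ->
    tr X i j k J (prj X i j x) = prj X k J x'.

Lemma sys_prj_inj X j (x y : stp X j) : is_system X ->
  (forall i, (i <= j)%O -> prj X i j x = prj X i j y) -> x = y.
Proof.
move=> sX xy; apply/eqP; rewrite -subr_eq0; apply/eqP; apply: (sys_sep sX) => i ij.
by rewrite linearB /= xy // subrr.
Qed.

(** The difference of the two representatives, taken at a common step, is zero in the
    colimit, hence has zero components at some later step. *)
Lemma sys_join X : is_system X -> forall j (x : stp X j) j1 (x1 : stp X j1),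
  inc X j x = inc X j1 x1 -> exists J (x' : stp X J),
  [/\ (j <= J)%O, (j1 <= J)%O, inc X J x' = inc X j x, extends x x' & extends x1 x'].
Proof.
move=> sX j x j1 x1 xx1; have [J0 [jJ0 j1J0]] := sys_upper sX j j1.
have [x' [ix' xx']] := sys_extend sX x jJ0.
have [x1' [ix1' xx1']] := sys_extend sX x1 j1J0.
have [|J [J0J zJ]] := @sys_zero _ sX _ (x' - x1').
  by rewrite linearB /= ix' ix1' xx1 subrr.
have [y [iy x'y]] := sys_extend sX x' J0J.
have [y1 [iy1 x1'y1]] := sys_extend sX x1' J0J.
have yy1 : y = y1.
  apply: (sys_prj_inj sX) => k kJ; have [i [iJ0 ik]] := sys_lower sX J0 k.
  rewrite -(x'y i) // -(x1'y1 i) //; apply/eqP; rewrite -subr_eq0 -!linearB /=.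
  by rewrite zJ.
have ext i0 i1 i2 (a : stp X i0) (b : stp X i1) (c : stp X i2) :
    (i0 <= i1)%O -> (i1 <= i2)%O -> extends a b -> extends b c -> extends a c.
  move=> i01 i12 ab bc i k ii0 ki2 ik; have [h [hi h1]] := sys_lower sX i i1.
  have hi0 := le_trans hi ii0.
  rewrite -(sys_prj sX a hi ii0) (sys_comp sX) //; last exact: le_trans i12.
  rewrite -(bc h) //; last exact: le_trans ik.
  rewrite -(ab h) // (sys_comp sX) //; last exact: le_trans ik.
exists J, y; split.
- exact: le_trans J0J.
- exact: le_trans J0J.
- by rewrite iy.
- exact: ext xx' x'y.
by rewrite yy1; apply: ext xx1' x1'y1.
Qed.

Section Families.
Variables (X Y : fmod C).
Variable M : forall i j k l, {linear car (quo X i j) -> car (quo Y k l)} -> Prop.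

Definition reaches j l : Prop := forall k, (k <= l)%O -> exists i m,
  (i <= j)%O /\ @M i j k l m.

(** A morphism of filtered modules does not induce maps F(j)/F(i) -> G(l)/G(k) for
    all indices, only for [l] large with respect to [j] and [i] small with respect to
    [k]. So [M] is a predicate singling out the maps that exist, any two of which are
    compatible with the transition maps. *)
Record is_family : Prop := IsFamily {
  fam_comm : forall i j k l i' j' k' l' m m', @M i j k l m -> @M i' j' k' l' m' ->
    (i <= j)%O -> (k <= l)%O -> (i' <= j')%O -> (k' <= l')%O ->
    (i <= i')%O -> (j <= j')%O -> (k <= k')%O -> (l <= l')%O ->
    forall e, tr Y k l k' l' (m e) = m' (tr X i j i' j' e);
  fam_shrink : forall i j k l m, @M i j k l m -> (i <= j)%O -> (k <= l)%O ->
    exists i0, (i0 <= i)%O /\ forall i', (i' <= i0)%O -> exists m', @M i' j k l m';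
  fam_reaches : forall j, exists l, forall l', (l <= l')%O -> reaches j l'
}.

Definition sends j (x : stp X j) l (y : stp Y l) : Prop := forall k, (k <= l)%O ->
  exists i m, [/\ (i <= j)%O, @M i j k l m & prj Y k l y = m (prj X i j x)].

Hypotheses (sX : is_system X) (sY : is_system Y) (famM : is_family).

(** A component of the image may be computed from components of [x] of arbitrarily small
    index, which makes two such computations comparable. *)
Lemma fam_restrict i j k l m i1 : @M i j k l m -> (i <= j)%O -> (k <= l)%O ->
  exists i' m', [/\ (i' <= i)%O, (i' <= i1)%O, @M i' j k l m' &
    forall x : stp X j, m (prj X i j x) = m' (prj X i' j x)].
Proof.
move=> Mm ij kl; have [i0 [i0i Mi0]] := fam_shrink famM Mm ij kl.
have [i' [i'i0 i'i1]] := sys_lower sX i0 i1; have [m' Mm'] := Mi0 _ i'i0.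
have i'i := le_trans i'i0 i0i.
exists i', m'; split=> // x; rewrite -(sys_prj sX x i'i ij).
rewrite -(fam_comm famM Mm' Mm) ?(sys_id sY) //; exact: le_trans ij.
Qed.

Lemma sends_extends j (x : stp X j) l (y : stp Y l) : sends x y ->
  forall j' (x' : stp X j') l' (y' : stp Y l'), (j <= j')%O -> (l <= l')%O ->
  extends x x' -> extends y y' -> forall i k m, (i <= j')%O -> (k <= l')%O ->
  @M i j' k l' m -> prj Y k l' y' = m (prj X i j' x').
Proof.
move=> xy j' x' l' y' jj' ll' xx' yy' i k m ij' kl' Mm.
have [k0 [k0l k0k]] := sys_lower sY l k.
have [i0 [m0 [i0j Mm0 ym0]]] := xy _ k0l.
have [i1 [m1 [i1i0 i1i Mm1 m0m1]]] := fam_restrict i Mm0 i0j k0l.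
have i1j := le_trans i1i0 i0j.
by rewrite -(yy' k0) // ym0 m0m1 (fam_comm famM Mm1 Mm) // (xx' i1).
Qed.

Lemma extends_refl Z (sZ : is_system Z) j (x : stp Z j) : extends x x.
Proof. by move=> i k ij kj ik; rewrite (sys_prj sZ). Qed.

Lemma sendsE j (x : stp X j) l (y : stp Y l) : sends x y ->
  forall i k m, (i <= j)%O -> (k <= l)%O -> @M i j k l m ->
  prj Y k l y = m (prj X i j x).
Proof.
by move=> xy i k m ij kl Mm; apply: (sends_extends xy) Mm => //; apply: extends_refl.
Qed.

(** Both images are moved to one late step, where each component is the value of the
    same member of the family at the same component of the common representative. *)
Lemma sends_uniq j (x : stp X j) l (y : stp Y l) j1 (x1 : stp X j1) l1 (y1 : stp Y l1) :
  sends x y -> sends x1 y1 -> inc X j x = inc X j1 x1 -> inc Y l y = inc Y l1 y1.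
Proof.
move=> xy x1y1 /(sys_join sX)[J [x' [jJ j1J _ xx' x1x']]].
have [L0 JL0] := fam_reaches famM J.
have [L1 [lL1 l1L1]] := sys_upper sY l l1.
have [L [L0L L1L]] := sys_upper sY L0 L1.
have lL := le_trans lL1 L1L; have l1L := le_trans l1L1 L1L.
have [y' [<- yy']] := sys_extend sY y lL.
have [y1' [<- y1y1']] := sys_extend sY y1 l1L.
congr (inc Y L _); apply: (sys_prj_inj sY) => k kL.
have [i [m [iJ Mm]]] := JL0 _ L0L _ kL.
rewrite (sends_extends xy jJ lL xx' yy' iJ kL Mm).
by rewrite (sends_extends x1y1 j1J l1L x1x' y1y1' iJ kL Mm).
Qed.

Lemma sends_lift j l : is_complete_system Y -> reaches j l ->
  forall x : stp X j, exists y : stp Y l, sends x y.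
Proof.
move=> cY jl x.
pose P k (e : car (quo Y k l)) := (k <= l)%O -> exists i m,
  [/\ (i <= j)%O, @M i j k l m & e = m (prj X i j x)].
have /(_ _)/cid - e k : exists e, @P k e.
  have [kl|kl] := boolP (k <= l)%O; last by exists 0 => kl'; rewrite kl' in kl.
  by have [i [m [ij Mm]]] := jl _ kl; exists (m (prj X i j x)) => _; exists i, m.
have [|y ye] := cY l (fun k => projT1 (e k)).
  move=> k k' kk' k'l; case: (e k) (e k') => [a Pa] [b Pb] /=.
  have kl := le_trans kk' k'l.
  have [i [m [ij Mm ->]]] := Pa kl; have [i' [m' [i'j Mm' ->]]] := Pb k'l.
  have [i1 [m1 [i1i i1i' Mm1 ->]]] := fam_restrict i' Mm ij kl.
  rewrite (fam_comm famM Mm1 Mm') // ?(sys_prj sX) //.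
  exact: le_trans i'j.
exists y => k kl; rewrite ye //; case: (e k) => a Pa /=.
by have [i [m [ij Mm ->]]] := Pa kl; exists i, m.
Qed.

Lemma sends_lin j l (x x' : stp X j) (y y' : stp Y l) a :
  sends x y -> sends x' y' -> sends (a *: x + x') (a *: y + y').
Proof.
move=> xy xy' k kl; have [i [m [ij Mm e]]] := xy _ kl.
exists i, m; split=> //; rewrite !linearP /= e; congr (_ + _).
exact: (sendsE xy').
Qed.

(** Completeness of [Y] provides an image for each representative of an element,
    [sends_uniq] makes it independent of the representative, and both summands of a sum
    can be represented at one step. *)
Lemma family_map : is_complete_system Y -> exists g : {linear tot X -> tot Y},
  [/\ forall j (x : stp X j) l (y : stp Y l), sends x y -> g (inc X j x) = inc Y l y &
      forall g' : tot X -> tot Y,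
      (forall j (x : stp X j) l (y : stp Y l), sends x y -> g' (inc X j x) = inc Y l y) ->
      g' =1 g].
Proof.
move=> cY; have sends_ex j : exists l, forall x : stp X j, exists y : stp Y l, sends x y.
  have [l jl] := fam_reaches famM j; exists l; apply: sends_lift => //.
  exact: jl.
pose P z w := exists j (x : stp X j) l (y : stp Y l),
  [/\ z = inc X j x, w = inc Y l y & sends x y].
have /(_ _)/cid - g z : exists w, P z w.
  have [j [x zx]] := sys_cover sX z; have [l /(_ x)[y xy]] := sends_ex j.
  by exists (inc Y l y), j, x, l, y.
pose h z := projT1 (g z).
have hE j (x : stp X j) l (y : stp Y l) : sends x y -> h (inc X j x) = inc Y l y.
  move=> xy; rewrite /h; case: (g _) => w Pw /=.
  have [j1 [x1 [l1 [y1 [e -> xy1]]]]] := Pw.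
  by apply: sends_uniq xy1 xy _.
have h_lin : linear h.
  move=> a u v; have [j [x ->]] := sys_cover sX u; have [j' [x' ->]] := sys_cover sX v.
  have [J [jJ j'J]] := sys_upper sX j j'.
  have [X1 [<- _]] := sys_extend sX x jJ; have [X1' [<- _]] := sys_extend sX x' j'J.
  have [l xl] := sends_ex J; have [y xy] := xl X1; have [y' xy'] := xl X1'.
  rewrite -linearP (hE _ _ _ _ xy) (hE _ _ _ _ xy') -linearP.
  by apply: hE; apply: sends_lin.
pose hL : {linear tot X -> tot Y} :=
  HB.pack h (GRing.isLinear.Build R (tot X) (tot Y) _ h h_lin).
exists hL; split=> // g' g'E z.
have [j [x ->]] := sys_cover sX z; have [l /(_ x)[y xy]] := sends_ex j.
by rewrite (g'E _ _ _ _ xy) -(hE _ _ _ _ xy).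
Qed.

End Families.

Lemma the_linearP (U V : lmodType R) (P : set {linear U -> V}) g :
  P g -> (forall g', P g' -> g' =1 g) -> P (the_linear P).
Proof.
move=> Pg Pu; rewrite /the_linear; case: pselect => [e|[]]; last by exists g.
by case: cid => h [].
Qed.

Lemma lim_mapE X Y S : is_system X -> is_system Y -> is_complete_system Y ->
  let M i j k l m := exists2 f, S i j k l f & m = amap f in is_family M ->
  forall j (x : stp X j) l (y : stp Y l), sends M x y ->
  lim_map S (inc X j x) = inc Y l y.
Proof.
move=> sX sY cY M famM; have [g [gE gu]] := family_map sX sY famM cY.
have SM j (x : stp X j) l (y : stp Y l) :
    (forall k, (k <= l)%O -> exists i (f : arr (quo X i j) (quo Y k l)),
       [/\ (i <= j)%O, S i j k l f & prj Y k l y = amap f (prj X i j x)]) <-> sends M x y.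
  split=> xy k kl; have := xy _ kl.
    by case=> i [f [ij Sf ->]]; exists i, (amap f); split=> //; exists f.
  by case=> i [m [ij [f Sf ->]] ->]; exists i, f.
have := @the_linearP _ _ [set g : {linear tot X -> tot Y} | forall j (x : stp X j) j' (y : stp Y j'),
    (forall k, (k <= j')%O -> exists i (f : arr (quo X i j) (quo Y k j')),
       [/\ (i <= j)%O, S i j k j' f & prj Y k j' y = amap f (prj X i j x)]) ->
    g (inc X j x) = inc Y j' y]%classic g.
rewrite -/(lim_map S) /= => H j x l y /SM xy; apply: H xy => [|g' g'E].
  by move=> j1 x1 l1 y1 /SM; apply: gE.
by apply: gu => j1 x1 l1 y1 /SM; apply: g'E.
Qed.

(** The maps [e i j] generate a family by composition with the transition maps of [Y];
    it reaches [c j] from [j]. *)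
Lemma lim_unitE X Y (c : idx X -> idx Y)
    (e : forall i j, {linear car (quo X i j) -> car (quo Y (c i) (c j))}) :
  is_system X -> is_system Y -> is_complete_system Y ->
  {mono c : i j / (i <= j)%O} -> (forall k, exists i, c i = k) ->
  (forall i j k l, (i <= j)%O -> (k <= l)%O -> (i <= k)%O -> (j <= l)%O ->
     forall a, tr Y (c i) (c j) (c k) (c l) (e i j a) = e k l (tr X i j k l a)) ->
  forall j (x : stp X j), exists y : stp Y (c j),
    (forall i, (i <= j)%O -> prj Y (c i) (c j) y = e i j (prj X i j x)) /\
    lim_unit e (inc X j x) = inc Y (c j) y.
Proof.
move=> sX sY cY c_le c_surj e_nat.
pose M i j k l (m : {linear car (quo X i j) -> car (quo Y k l)}) :=
  [/\ (c i <= k)%O, (c j <= l)%O & m =1 tr Y (c i) (c j) k l \o e i j].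
have MM i j k l : (c i <= k)%O -> (c j <= l)%O -> exists m, M i j k l m.
  by move=> ik jl; exists (tr Y (c i) (c j) k l \o e i j).
have reaches_c j l : (c j <= l)%O -> reaches M j l.
  move=> jl k kl; have [k0 k0k] := c_surj k; have [i [ij ik]] := sys_lower sX j k0.
  have [|m Mm] := MM i j k l _ jl; first by rewrite -k0k c_le.
  by exists i, m.
have famM : is_family M.
  split=> [i j k l i' j' k' l' m m' [ik jl mE] [i'k' j'l' mE'] ij kl ij' kl' ii' jj' kk' ll' a|
           i j k l m [ik jl mE] ij kl|j].
  - rewrite mE mE' /= -e_nat // !(sys_comp sY) ?c_le //.
  - exists i; split=> // i' i'i; apply: MM => //.
    by rewrite (le_trans _ ik) // c_le.
  - by exists (c j); apply: reaches_c.
have sendsP j (x : stp X j) (y : stp Y (c j)) : sends M x y <->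
    forall i, (i <= j)%O -> prj Y (c i) (c j) y = e i j (prj X i j x).
  split=> [xy i ij|xy k kj].
    have cij : (c i <= c j)%O by rewrite c_le.
    have Mi : M i j (c i) (c j) (tr Y (c i) (c j) (c i) (c j) \o e i j) by split.
    by rewrite (sendsE sX sY famM xy ij cij Mi) /= (sys_id sY).
  have [i ik] := c_surj k; rewrite -ik in kj *; have ij : (i <= j)%O by rewrite -c_le.
  exists i, (tr Y (c i) (c j) (c i) (c j) \o e i j); split=> //.
  by rewrite /= (sys_id sY) // xy.
have lift j (x : stp X j) : exists y : stp Y (c j), sends M x y.
  by apply: (sends_lift sX sY famM cY); apply: reaches_c.
have [g [gE gu]] := family_map sX sY famM cY.
have := @the_linearP _ _ [set g : {linear tot X -> tot Y} |
  forall j (x : stp X j) (y : stp Y (c j)),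
    (forall i, (i <= j)%O -> prj Y (c i) (c j) y = e i j (prj X i j x)) ->
    g (inc X j x) = inc Y (c j) y]%classic g.
rewrite -/(lim_unit e) /= => H j x; have [y xy] := lift j x.
exists y; split; first exact/sendsP.
apply: H => [j1 x1 y1 /sendsP|g' g'E z|]; [exact: gE| |exact/sendsP].
have [j1 [x1 ->]] := sys_cover sX z; have [y1 xy1] := lift j1 x1.
by rewrite (gE _ _ _ _ xy1); apply: g'E; apply/sendsP.
Qed.

End Systems.

Arguments tr {R C} X i j k l.

Section LimSystem.
Variables (R : comPzRingType) (C : level R) (d : Order.disp_t) (I : porderType d).
Variables (E : I -> I -> ob C) (T : forall i j k l, arr (E i j) (E k l)).
Hypothesis filtI : filtering I.
Hypothesis I0 : I.
Hypothesis T_id : forall i j, (i <= j)%O -> forall e, amap (T i j i j) e = e.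
Hypothesis T_comp : forall i j k l m p, (i <= j)%O -> (k <= l)%O -> (m <= p)%O ->
  (i <= k)%O -> (j <= l)%O -> (k <= m)%O -> (l <= p)%O ->
  forall e, amap (T k l m p) (amap (T i j k l) e) = amap (T i j m p) e.

Lemma lim_fmod_system : is_system (lim_fmod T).
Proof.
split=> //.
- exact: (colim_cover filtI T_comp I0).
- move=> j x x0; apply: limmod_ext => i ij; rewrite linear0; exact: x0.
- by move=> i j k x ik kj; apply: limmod_tr.
- move=> j j' x jj'; have [y xy] := extend_limmod filtI T_comp x jj'.
  have {}xy := (lim_transP filtI T_comp x y jj').1 xy.
  by exists y; split=> //=; rewrite (colim_inj_trans jj' xy).
move=> j x /= /(colim_inj_eq0 filtI T_comp I0) [j' [jj' x0]]; exists j'; split=> // i k ij kj' ik.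
by rewrite -(x0 k) // (extendE filtI T_comp _ jj' kj' ij ik).
Qed.

Lemma lim_fmod_complete : is_complete_system (lim_fmod T).
Proof. by move=> j e eT; apply: limmod_lift. Qed.

End LimSystem.

(** * Strong objects *)

Lemma linear_ext (R : comPzRingType) (U V : lmodType R) (f g : {linear U -> V}) :
  f =1 g -> f = g.
Proof.
case: f g => f [[f1] [f2]] [g [[g1] [g2]]] /= /funext fg.
case: _ / fg g1 g2 => g1 g2.
by rewrite (Prop_irrelevance f1 g1) (Prop_irrelevance f2 g2).
Qed.

Lemma strong_obj (R : comPzRingType) n (X : ob (lvl R n)) : strong X -> isobj X.
Proof. by case: n X => [|n] X //= []. Qed.

Section Objects.
Variables (R : comPzRingType) (n : nat).
Implicit Types X Y Z : fmod (lvl R n).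

Section Object.
Variable X : fmod (lvl R n).
Hypothesis objX : @isobj R n.+1 X.

Lemma obj_filt : is_filtration X. Proof. by have [] := objX. Qed.

Lemma obj_filtering : filtering (idx X).
Proof. exact: idx_filtering obj_filt. Qed.

Lemma obj_idx : idx X.
Proof.
have : (\bigcup_i range (inc X i))%classic 0 by rewrite (filt_cup obj_filt).
by move=> H; case: (cid2 H).
Qed.

Lemma obj_quo i j : (i <= j)%O -> isobj (quo X i j).
Proof. by have [_ H _] := objX; apply: H. Qed.

Lemma obj_le i j (x : stp X i) : (i <= j)%O -> exists y : stp X j, inc X j y = inc X i x.
Proof.
move=> ij; have [|y _ xy] := @inc_mono _ _ _ obj_filt _ _ ij (inc X i x).
  by exists x.
by exists y.
Qed.

Lemma obj_inj i : injective (inc X i).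
Proof. exact: (Defs.inc_inj obj_filt). Qed.

Lemma obj_prj i j (e : car (quo X i j)) : (i <= j)%O -> exists x, prj X i j x = e.
Proof. by move=> /(prj_surj obj_filt) /(_ e I)[x _ <-]; exists x. Qed.

Lemma obj_prj0 i j (x : stp X j) : (i <= j)%O ->
  prj X i j x = 0 <-> exists y, inc X j x = inc X i y.
Proof.
move=> ij; split=> [/(prj_ker obj_filt ij)[y _ xy]|[y xy]]; first by exists y.
by apply/(prj_ker obj_filt ij); exists y.
Qed.

Lemma obj_tr i j k l (x : stp X j) (y : stp X l) :
  (i <= j)%O -> (k <= l)%O -> (i <= k)%O -> (j <= l)%O ->
  inc X j x = inc X l y -> tr X i j k l (prj X i j x) = prj X k l y.
Proof.
move=> ij kl ik jl xy; have [_ _ H] := objX.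
by have [H1 _ _] := H _ _ _ _ ij kl ik jl; apply: H1.
Qed.

Lemma obj_tr_mor i j k l : (i <= j)%O -> (k <= l)%O -> (i <= k)%O -> (j <= l)%O ->
  ismor (tr X i j k l).
Proof. by move=> ij kl ik jl; have [_ _ H] := objX; have [] := H _ _ _ _ ij kl ik jl. Qed.

Lemma obj_tr_canon i j k l : (i <= j)%O -> (k <= l)%O -> (i <= k)%O -> (j <= l)%O ->
  trn X i j k l = Defs.canon (tr X i j k l).
Proof. by move=> ij kl ik jl; have [_ _ H] := objX; have [] := H _ _ _ _ ij kl ik jl. Qed.

Lemma obj_tr_inj k l l' : (k <= l)%O -> (l <= l')%O -> injective (tr X k l k l').
Proof.
move=> kl ll' a b; have kl' := le_trans kl ll'.
have [x <-] := obj_prj a kl; have [y <-] := obj_prj b kl => /eqP.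
rewrite -subr_eq0 -!linearB /=; have [z zE] := obj_le (x - y) ll'.
rewrite (obj_tr _ _ _ _ (esym zE)) // => /eqP/(obj_prj0 _ kl')[w zw].
apply/eqP; rewrite -subr_eq0 -linearB /=; apply/eqP/(obj_prj0 _ kl).
by exists w; rewrite -zE.
Qed.

Lemma obj_cap (z : tot X) : (forall i, exists x, z = inc X i x) -> z = 0.
Proof.
move=> zi; have : (\bigcap_i range (inc X i))%classic z.
  by move=> i _; have [x ->] := zi i; exists x.
by rewrite (filt_cap obj_filt).
Qed.

Lemma obj_sep j (x : stp X j) : (forall i, (i <= j)%O -> prj X i j x = 0) -> x = 0.
Proof.
move=> x0; apply: (@obj_inj j); rewrite linear0; apply: obj_cap => i.
have [[k [ki kj]] _] := obj_filtering i j.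
have [y ->] := (obj_prj0 x kj).1 (x0 _ kj).
by have [w <-] := obj_le y ki; exists w.
Qed.

Lemma obj_system : is_system X.
Proof.
split.
- exact: obj_filtering.
- move=> z; have : (\bigcup_i range (inc X i))%classic z by rewrite (filt_cup obj_filt).
  by case=> i _ [x _ <-]; exists i, x.
- exact: obj_sep.
- by move=> i j k x ik kj; apply: obj_tr => //; apply: le_trans kj.
- by move=> i j ij e; have [x <-] := obj_prj e ij; apply: obj_tr.
- move=> i j k l m p ij kl mp ik jl km lp e; have [x <-] := obj_prj e ij.
  have [y xy] := obj_le x jl; have [z yz] := obj_le y lp.
  rewrite (obj_tr ij kl ik jl (esym xy)) (obj_tr kl mp km lp (esym yz)).
  symmetry; apply: obj_tr => //; first exact: le_trans km.
    exact: le_trans lp.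
  by rewrite yz.
- move=> j j' x jj'; have [y xy] := obj_le x jj'; exists y; split=> // i k ij kj' ik.
  exact: obj_tr.
move=> j x x0; exists j; split=> // i k ij kj ik.
have -> : x = 0 by apply: (@obj_inj j); rewrite linear0.
by rewrite !linear0.
Qed.

End Object.

Definition induces X Y (f : tot X -> tot Y) i j k l
    (g : {linear car (quo X i j) -> car (quo Y k l)}) : Prop :=
  induced f g /\ ismor g.

Lemma ismor_range X Y (f : {linear tot X -> tot Y}) : @isobj R n.+1 Y ->
  @ismor R n.+1 X Y f -> forall j, exists l, forall l', (l <= l')%O ->
  forall x : stp X j, exists y : stp Y l', f (inc X j x) = inc Y l' y.
Proof.
move=> objY fm j; have [i0 [l [i0j kl H]]] := fm j (obj_idx objY).
exists l => l' ll' x; have [g [[_ gi] _]] := H i0 l' (lexx _) ll'.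
by have [y [-> _]] := gi x; exists y.
Qed.

(** The definition of a morphism lets the target step grow when [k] decreases, whereas
    an element of lim_k G(l)/G(k) has to be built at a fixed [l]. In a strong object the
    target can be shrunk back to any [l] whose step contains the image of F(j), since
    G(l)/G(k) -> G(l')/G(k) is the kernel of the projection to G(l')/G(l). *)
Lemma ismor_induces X Y (f : {linear tot X -> tot Y}) : @isobj R n.+1 X ->
  @strong R n.+1 Y -> @ismor R n.+1 X Y f -> forall j l,
  (forall x : stp X j, exists y : stp Y l, f (inc X j x) = inc Y l y) ->
  forall k, (k <= l)%O -> exists i0, (i0 <= j)%O /\ forall i, (i <= i0)%O ->
  exists g : {linear car (quo X i j) -> car (quo Y k l)}, induces f g.
Proof.
move=> objX strY fm j l fjl k kl; have objY := strong_obj strY.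
have [i0 [l0 [i0j kl0 H]]] := fm j k; exists i0; split=> // i ii0.
have [_ [l' [ll' l0l']]] := obj_filtering objY l l0.
have [g [[g1 g2] gm]] := H i l' ii0 l0l'; have ij := le_trans ii0 i0j.
have [_ _ /(_ k l l' kl ll')[[trm tr0 tru] _]] := strY.
have kl' := le_trans kl ll'.
have gE (x : stp X j) (y : stp Y l) : f (inc X j x) = inc Y l y ->
    g (prj X i j x) = tr Y k l k l' (prj Y k l y).
  move=> fxy; have [z [fz ->]] := g2 x; symmetry; apply: obj_tr => //.
  by rewrite -fz.
have [|h [hm hg _]] := tru _ g (obj_quo objX ij) gm.
  move=> w; have [x <-] := obj_prj objX w ij.
  have [y fy] := fjl x; rewrite (gE _ _ fy) -[RHS](tr0 (prj Y k l y)).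
  by [].
exists h; split=> //; split=> // x; have [y fy] := fjl x; exists y; split=> //.
apply: (obj_tr_inj objY kl ll'); rewrite -(gE _ _ fy).
exact: hg.
Qed.

End Objects.

Lemma ismor_id (R : comPzRingType) n (X : ob (lvl R n)) : isobj X ->
  ismor (idfun : {linear car X -> car X}).
Proof.
case: n X => [//|n] X objX i j /=.
have [[i0 [i0i i0j]] [j0 [ij0 jj0]]] := obj_filtering objX i j.
exists i0, j0; split=> // i' j' i'i0 j0j'.
have i'i := le_trans i'i0 i0i; have i'j := le_trans i'i0 i0j.
have jj' := le_trans jj0 j0j'; have ij' := le_trans ij0 j0j'.
exists (tr X i' i j j'); split; last exact: obj_tr_mor.
split=> x; first by have [y <-] := obj_le objX x i'j; exists y.
have [y xy] := obj_le objX x ij'; exists y; split=> //.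
exact: obj_tr.
Qed.

(** * Passing to the limit over subquotients *)

(** A functor together with a candidate natural transformation from the identity. *)
Record ufunctor (R : comPzRingType) (C : level R) := UFunctor {
  ufun :> functor C;
  uunit : forall X, {linear car X -> car (fob ufun X)}
}.
Arguments uunit {R C} u X.

Definition ustep (R : comPzRingType) (C : level R) (U : ufunctor C) :
    ufunctor (filtered C) :=
  @UFunctor R (filtered C) (compl_step U) (fun X : fmod C =>
    lim_unit (X := X) (Y := fob (compl_step U) X) (c := id)
      (fun i j => uunit U (quo X i j))).

Definition umap (R : comPzRingType) n (U : ufunctor (lvl R n)) (X Y : ob (lvl R n))
    (f : {linear car X -> car Y}) : {linear car (fob U X) -> car (fob U Y)} :=
  amap (farrow U (Defs.canon f)).

(** What is propagated from one level to the next. Functoriality is stated for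
    commuting squares: with an identity as one side it contains compatibility with
    composition, and it does not presuppose that the composite is a morphism. In the
    last clause [Z] is arbitrary: taking [g] to be the identity shows that the unit is a
    morphism, and the general case survives the passage to subquotients. *)
Record regular (R : comPzRingType) n (U : ufunctor (lvl R n)) : Prop := Regular {
  reg_id : forall X : ob (lvl R n), strong X ->
    umap U (idfun : {linear car X -> car X}) =1 id;
  reg_square : forall (X Y Y' Z : ob (lvl R n)) (f : {linear car X -> car Y})
      (g : {linear car Y -> car Z}) (f' : {linear car X -> car Y'})
      (g' : {linear car Y' -> car Z}),
    strong X -> strong Y -> strong Y' -> strong Z ->
    ismor f -> ismor g -> ismor f' -> ismor g' -> g \o f =1 g' \o f' ->
    umap U g \o umap U f =1 umap U g' \o umap U f';
  reg_mor : forall (X Y : ob (lvl R n)) (f : {linear car X -> car Y}),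
    strong X -> strong Y -> ismor f -> ismor (umap U f);
  reg_nat : forall (X Y : ob (lvl R n)) (f : {linear car X -> car Y}),
    strong X -> strong Y -> ismor f -> umap U f \o uunit U X =1 uunit U Y \o f;
  reg_inj : forall X : ob (lvl R n), strong X -> injective (uunit U X);
  reg_post : forall (Z X : ob (lvl R n)) (g : {linear car Z -> car X}),
    strong X -> ismor g -> ismor (uunit U X \o g)
}.

Lemma strong_quo (R : comPzRingType) n (X : fmod (lvl R n)) : @strong R n.+1 X ->
  forall i j, (i <= j)%O -> strong (quo X i j).
Proof. by move=> strX i j ij; have [_ H _] := strX; apply: H. Qed.

Section Step.
Variables (R : comPzRingType) (n : nat) (U : ufunctor (lvl R n)).
Hypothesis gU : regular U.
Implicit Types X Y Z : fmod (lvl R n).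

Definition ulim X : fmod (lvl R n) :=
  lim_fmod (fun i j k l : idx X => farrow U (trn X i j k l)).

Section OnObject.
Variable X : fmod (lvl R n).
Hypothesis strX : @strong R n.+1 X.
Let objX : @isobj R n.+1 X := strong_obj strX.

Lemma ulim_tr i j k l : (i <= j)%O -> (k <= l)%O -> (i <= k)%O -> (j <= l)%O ->
  tr (ulim X) i j k l = umap U (tr X i j k l).
Proof. by move=> ij kl ik jl; rewrite /umap -(obj_tr_canon objX). Qed.

Lemma ulim_id i j : (i <= j)%O -> forall e, tr (ulim X) i j i j e = e.
Proof.
move=> ij e; rewrite ulim_tr // (_ : tr X i j i j = idfun).
  exact: (reg_id gU (strong_quo strX ij)).
by apply: linear_ext => a; apply: (sys_id (obj_system objX)).
Qed.

Lemma ulim_comp i j k l m p : (i <= j)%O -> (k <= l)%O -> (m <= p)%O ->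
  (i <= k)%O -> (j <= l)%O -> (k <= m)%O -> (l <= p)%O ->
  forall e, tr (ulim X) k l m p (tr (ulim X) i j k l e) = tr (ulim X) i j m p e.
Proof.
move=> ij kl mp ik jl km lp e; have im := le_trans ik km; have jp := le_trans jl lp.
rewrite -[RHS](ulim_id mp) !ulim_tr //; pose S := strong_quo strX.
pose tm := obj_tr_mor objX.
apply: (reg_square gU (S _ _ ij) (S _ _ kl) (S _ _ mp) (S _ _ mp) (tm _ _ _ _ ij kl ik jl)
  (tm _ _ _ _ kl mp km lp) (tm _ _ _ _ ij mp im jp) (tm _ _ _ _ mp mp (lexx _) (lexx _))).
move=> a /=; rewrite (sys_id (obj_system objX)) //.
exact: (sys_comp (obj_system objX)).
Qed.

Lemma ulim_system : is_system (ulim X).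
Proof.
apply: lim_fmod_system; [exact: obj_filtering|exact: obj_idx|exact: ulim_id|].
exact: ulim_comp.
Qed.

Lemma ulim_complete : is_complete_system (ulim X).
Proof. exact: lim_fmod_complete. Qed.

Lemma unit_stepE j (x : stp X j) : exists y : stp (ulim X) j,
  (forall i, (i <= j)%O -> prj (ulim X) i j y = uunit U _ (prj X i j x)) /\
  uunit (ustep U) X (inc X j x) = inc (ulim X) j y.
Proof.
apply: (lim_unitE (X := X) (Y := ulim X) (c := id)) => //.
- exact: obj_system.
- exact: ulim_system.
- exact: ulim_complete.
- by move=> k; exists k.
move=> i k i' k' ik i'k' ii' kk' a; rewrite ulim_tr //.
have S := strong_quo strX.
exact: (reg_nat gU (S _ _ ik) (S _ _ i'k') (obj_tr_mor objX ik i'k' ii' kk')).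
Qed.

End OnObject.

Section OnMorphism.
Variables (X Y : fmod (lvl R n)) (f : {linear tot X -> tot Y}).
Hypotheses (strX : @strong R n.+1 X) (strY : @strong R n.+1 Y).
Hypothesis fm : @ismor R n.+1 X Y f.
Let objX : @isobj R n.+1 X := strong_obj strX.
Let objY : @isobj R n.+1 Y := strong_obj strY.
Let sX := ulim_system strX.
Let sY := ulim_system strY.

Definition ufam i j k l
    (m : {linear car (quo (ulim X) i j) -> car (quo (ulim Y) k l)}) : Prop :=
  exists2 h, [set farrow U h | h in sarr (@Defs.canon R n.+1 X Y f) i j k l]%classic h
    & m = amap h.

Lemma ufamP i j k l m : @ufam i j k l m <->
  exists g : {linear car (quo X i j) -> car (quo Y k l)}, induces f g /\ m = umap U g.
Proof.
split=> [[_ [_ [g [fg gm ->]] <-] ->]|[g [[fg gm] ->]]]; first by exists g.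
by exists (farrow U (Defs.canon g)) => //; exists (Defs.canon g) => //; exists g.
Qed.

Definition carries j l : Prop :=
  forall x : stp X j, exists y : stp Y l, f (inc X j x) = inc Y l y.

Lemma induces_carries i j k l (g : {linear car (quo X i j) -> car (quo Y k l)}) :
  induces f g -> carries i k /\ carries j l.
Proof. by move=> [[g1 g2] _]; split=> // x; have [y []] := g2 x; exists y. Qed.

Lemma inducesE i j k l (g : {linear car (quo X i j) -> car (quo Y k l)}) :
  induces f g -> (k <= l)%O -> forall (x : stp X j) (y : stp Y l),
  f (inc X j x) = inc Y l y -> g (prj X i j x) = prj Y k l y.
Proof.
move=> [[_ g2] _] kl x y fxy; have [z [fz ->]] := g2 x; congr (prj Y k l _).
by apply: (obj_inj objY); rewrite -fz.
Qed.

Lemma ufam_small j l k : carries j l -> (k <= l)%O -> exists i0, (i0 <= j)%O /\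
  forall i, (i <= i0)%O -> exists g : {linear car (quo X i j) -> car (quo Y k l)},
  induces f g /\ ufam (umap U g).
Proof.
move=> fjl kl; have [i0 [i0j H]] := ismor_induces objX strY fm fjl kl.
exists i0; split=> // i ii0; have [g fg] := H _ ii0; exists g; split=> //.
by apply/ufamP; exists g.
Qed.

Lemma ufam_reaches j l : carries j l -> reaches ufam j l.
Proof.
move=> fjl k kl; have [i [ij H]] := ufam_small fjl kl.
by have [g [_ fg]] := H i (lexx _); exists i, (umap U g).
Qed.

Lemma carries_large j : exists l, forall l', (l <= l')%O -> carries j l'.
Proof. exact: ismor_range. Qed.

(** Compatibility with the transition maps is the image under [U] of commuting squares of
    morphisms between subquotients of [X] and [Y]. *)
Lemma ufam_family : is_family ufam.
Proof.
split=> [i j k l i' j' k' l' m m' /ufamP[g [fg ->]] /ufamP[g' [fg' ->]]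
           ij kl ij' kl' ii' jj' kk' ll' e|
         i j k l m /ufamP[g [fg _]] ij kl|j].
- rewrite !ulim_tr //; have SX := strong_quo strX; have SY := strong_quo strY.
  have gm := fg.2; have gm' := fg'.2.
  apply: (reg_square gU (SX _ _ ij) (SY _ _ kl) (SX _ _ ij') (SY _ _ kl') gm
    (obj_tr_mor objY kl kl' kk' ll') (obj_tr_mor objX ij ij' ii' jj') gm').
  move=> a /=; have [x <-] := obj_prj objX a ij.
  have [x' xx'] := obj_le objX x jj'; rewrite (obj_tr objX _ _ _ _ (esym xx')) //.
  have [_ /(_ x)[y fy]] := induces_carries fg.
  have [y' yy'] := obj_le objY y ll'.
  rewrite (inducesE fg kl fy) (obj_tr objY _ _ _ _ (esym yy')) //.
  by symmetry; apply: (inducesE fg'); rewrite // xx' fy yy'.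
- have [_ fjl] := induces_carries fg; have [i0 [i0j H]] := ufam_small fjl kl.
  have [[i1 [i1i i1i0]] _] := obj_filtering objX i i0.
  exists i1; split=> // i' i'i1; have [g' [_ fg']] := H i' (le_trans i'i1 i1i0).
  by exists (umap U g').
have [l H] := carries_large j; exists l => l' /H; exact: ufam_reaches.
Qed.

Lemma umap_stepE j (x : stp (ulim X) j) l (y : stp (ulim Y) l) :
  sends ufam x y -> @umap R n.+1 (ustep U) X Y f (inc (ulim X) j x) = inc (ulim Y) l y.
Proof.
pose S i j k l := [set farrow U h | h in sarr (@Defs.canon R n.+1 X Y f) i j k l]%classic.
exact: (@lim_mapE _ _ (ulim X) (ulim Y) S sX sY (ulim_complete (X := Y)) ufam_family).
Qed.

(** The map induced by [f] on the limits preserves the steps as [f] does, and its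
    components are the images under [U] of the maps induced by [f]. *)
Lemma umap_step_carries j l : carries j l -> forall x : stp (ulim X) j,
  exists y : stp (ulim Y) l,
  @umap R n.+1 (ustep U) X Y f (inc (ulim X) j x) = inc (ulim Y) l y /\
  forall i k (g : {linear car (quo X i j) -> car (quo Y k l)}), (i <= j)%O ->
    (k <= l)%O -> induces f g ->
    prj (ulim Y) k l y = umap U g (prj (ulim X) i j x).
Proof.
move=> fjl x.
have [y xy] := sends_lift sX sY ufam_family (ulim_complete (X := Y)) (ufam_reaches fjl) x.
exists y; split=> [|i k g ij kl fg]; first exact: umap_stepE.
by apply: (sendsE sX sY ufam_family xy ij kl); apply/ufamP; exists g.
Qed.

End OnMorphism.

End Step.

Section Levelwise.
Variables (R : comPzRingType) (n : nat) (X Y : fmod (lvl R n)) (c : idx X -> idx Y).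
Variable e : forall i j, {linear car (quo X i j) -> car (quo Y (c i) (c j))}.
Variable phi : {linear tot X -> tot Y}.

(** [phi] preserves the filtrations, with the same index up to [c], and induces [e] on the
    subquotients. *)
Definition levelwise : Prop := forall j (x : stp X j), exists y : stp Y (c j),
  (forall i, (i <= j)%O -> prj Y (c i) (c j) y = e i j (prj X i j x)) /\
  phi (inc X j x) = inc Y (c j) y.

Hypotheses (c_le : {mono c : i j / (i <= j)%O}) (c_surj : forall k, exists i, c i = k).
Hypothesis phi_level : levelwise.

(** As [phi] does not shift the indices, the bounds that witness that [g] is a morphism
    also serve for the composite. *)
Lemma ismor_post_level (Z : fmod (lvl R n)) (g : {linear tot Z -> tot X}) :
  (forall i j W (h : {linear car W -> car (quo X i j)}), (i <= j)%O ->
     ismor h -> ismor (e i j \o h)) ->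
  @ismor R n.+1 Z X g -> @ismor R n.+1 Z Y (phi \o g).
Proof.
move=> e_mor gm i k; have [k0 <-] := c_surj k.
have [i0 [l0 [i0i kl0 H]]] := gm i k0; exists i0, (c l0); split=> //.
  by rewrite c_le.
move=> i' l' i'i0; have [l1 <-] := c_surj l'; rewrite c_le => l0l1.
have [h [[h1 h2] hm]] := H i' l1 i'i0 l0l1; have kl1 := le_trans kl0 l0l1.
exists (e k0 l1 \o h); split; last exact: e_mor.
split=> x.
  have [y gxy] := h1 x; have [w [_ yw]] := phi_level y.
  by exists w; rewrite /= gxy.
have [y [gxy hxy]] := h2 x; have [w [wp yw]] := phi_level y.
by exists w; rewrite /= gxy hxy wp.
Qed.

Lemma ismor_pre_level (Z : fmod (lvl R n)) (g : {linear tot Y -> tot Z}) :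
  (forall i j W (h : {linear car (quo Y (c i) (c j)) -> car W}), (i <= j)%O ->
     ismor h -> ismor (h \o e i j)) ->
  @ismor R n.+1 Y Z g -> @ismor R n.+1 X Z (g \o phi).
Proof.
move=> e_mor gm i k; have [i0 [l0 [i0i kl0 H]]] := gm (c i) k.
have [i1 i1E] := c_surj i0; rewrite -{}i1E c_le in i0i H *.
exists i1, l0; split=> // i' l' i'i1 l0l'.
have [|h [[h1 h2] hm]] := H (c i') l' _ l0l'; first by rewrite c_le.
have i'i := le_trans i'i1 i0i.
exists (h \o e i' i); split; last exact: e_mor.
split=> x.
  have [y [_ xy]] := phi_level x; have [w yw] := h1 y.
  by exists w; rewrite /= xy.
have [y [yp xy]] := phi_level x; have [w [yw hw]] := h2 y.
by exists w; rewrite /= xy -yp.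
Qed.

End Levelwise.

Section RegularStep.
Variables (R : comPzRingType) (n : nat) (U : ufunctor (lvl R n)).
Hypothesis gU : regular U.
Implicit Types X Y Z : fmod (lvl R n).

Lemma step_id X : @strong R n.+1 X ->
  @umap R n.+1 (ustep U) X X idfun =1 id.
Proof.
move=> strX z; have objX : @isobj R n.+1 X := strong_obj strX.
have sX := ulim_system gU strX.
have [j [x ->]] := sys_cover sX z.
have cjj : carries (X := X) (Y := X) idfun j j by move=> a; exists a.
have [y [-> yp]] := umap_step_carries gU strX strX (@ismor_id R n.+1 X objX) cjj x.
congr (inc (ulim U X) j _); apply: (sys_prj_inj sX) => k kj.
have [i0 [i0j H]] := ismor_induces objX strX (@ismor_id R n.+1 X objX) cjj kj.
have [[i [ii0 ik]] _] := obj_filtering objX i0 k.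
have [g fg] := H i ii0; have ij := le_trans ii0 i0j; rewrite (yp _ _ _ ij kj fg).
have <- : tr X i j k j = g.
  apply: linear_ext => a; have [b <-] := obj_prj objX a ij.
  by rewrite (sys_prj (obj_system objX)) // (inducesE strX fg kj (y := b)).
by rewrite -ulim_tr // (sys_prj sX).
Qed.

(** Both composites send the class of [x] into a common step of the target, and there the
    components are compared one level below, for a source index so small that all four
    induced maps exist. *)
Lemma step_square X Y Y' Z (f : {linear tot X -> tot Y}) (g : {linear tot Y -> tot Z})
    (f' : {linear tot X -> tot Y'}) (g' : {linear tot Y' -> tot Z}) :
  @strong R n.+1 X -> @strong R n.+1 Y -> @strong R n.+1 Y' -> @strong R n.+1 Z ->
  @ismor R n.+1 X Y f -> @ismor R n.+1 Y Z g ->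
  @ismor R n.+1 X Y' f' -> @ismor R n.+1 Y' Z g' -> g \o f =1 g' \o f' ->
  @umap R n.+1 (ustep U) Y Z g \o @umap R n.+1 (ustep U) X Y f =1
  @umap R n.+1 (ustep U) Y' Z g' \o @umap R n.+1 (ustep U) X Y' f'.
Proof.
move=> strX strY strY' strZ fm gm fm' gm' gf z.
have objX : @isobj R n.+1 X := strong_obj strX.
have objZ : @isobj R n.+1 Z := strong_obj strZ.
have objY : @isobj R n.+1 Y := strong_obj strY.
have objY' : @isobj R n.+1 Y' := strong_obj strY'.
have [j [x ->]] := sys_cover (ulim_system gU strX) z.
have [jB /(_ _ (lexx _)) fB] := carries_large strY fm j.
have [jB' /(_ _ (lexx _)) fB'] := carries_large strY' fm' j.
have [jC gC] := carries_large strZ gm jB.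
have [jC' gC'] := carries_large strZ gm' jB'.
have [_ [l [jCl jC'l]]] := obj_filtering objZ jC jC'.
have [y [fxy yp]] := umap_step_carries gU strX strY fm fB x.
have [y' [fxy' yp']] := umap_step_carries gU strX strY' fm' fB' x.
have [w [gyw wp]] := umap_step_carries gU strY strZ gm (gC _ jCl) y.
have [w' [gyw' wp']] := umap_step_carries gU strY' strZ gm' (gC' _ jC'l) y'.
rewrite /= fxy fxy'; apply: etrans gyw _; apply: etrans (esym gyw').
congr (inc (ulim U Z) l _); apply: (sys_prj_inj (ulim_system gU strZ)) => k kl.
have [b [bB /(_ _ (lexx _)) [h gh]]] := ismor_induces objY strZ gm (gC _ jCl) kl.
have [b' [bB' /(_ _ (lexx _)) [h' gh']]] := ismor_induces objY' strZ gm' (gC' _ jC'l) kl.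
have [i1 [i1j H1]] := ismor_induces objX strY fm fB bB.
have [i2 [i2j H2]] := ismor_induces objX strY' fm' fB' bB'.
have [[i [ii1 ii2]] _] := obj_filtering objX i1 i2.
have [p fp] := H1 _ ii1; have [p' fp'] := H2 _ ii2; have ij := le_trans ii1 i1j.
rewrite (wp _ _ _ bB kl gh) (wp' _ _ _ bB' kl gh') (yp _ _ _ ij bB fp) (yp' _ _ _ ij bB' fp').
apply: (reg_square gU (strong_quo strX ij) (strong_quo strY bB)
  (strong_quo strY' bB') (strong_quo strZ kl) fp.2 gh.2 fp'.2 gh'.2) => a.
have [u <-] := obj_prj objX a ij.
have [v fuv] := fB u; have [v' fuv'] := fB' u.
have [q gvq] := gC _ jCl v.
rewrite /= (inducesE strY fp bB fuv) (inducesE strY' fp' bB' fuv').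
rewrite (inducesE strZ gh kl gvq); symmetry; apply: (inducesE strZ gh' kl).
by rewrite -fuv' -[LHS]/((g' \o f') (inc X j u)) -gf /= fuv.
Qed.

Lemma step_mor X Y (f : {linear tot X -> tot Y}) :
  @strong R n.+1 X -> @strong R n.+1 Y -> @ismor R n.+1 X Y f ->
  @ismor R n.+1 (ulim U X) (ulim U Y) (@umap R n.+1 (ustep U) X Y f).
Proof.
move=> strX strY fm i k; have [i0 [k0 [i0i kk0 H]]] := fm i k.
exists i0, k0; split=> // i' k' i'i0 k0k'; have [g fg] := H i' k' i'i0 k0k'.
have i'i := le_trans i'i0 i0i; have kk' := le_trans kk0 k0k'.
have [cik cik'] := induces_carries fg.
exists (umap U g); split.
  split=> x.
    by have [y [xy _]] := umap_step_carries gU strX strY fm cik x; exists y.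
  have [y [xy yp]] := umap_step_carries gU strX strY fm cik' x; exists y; split=> //.
  by symmetry; apply: yp.
exact: (reg_mor gU (strong_quo strX i'i) (strong_quo strY kk') fg.2).
Qed.

Lemma step_nat X Y (f : {linear tot X -> tot Y}) :
  @strong R n.+1 X -> @strong R n.+1 Y -> @ismor R n.+1 X Y f ->
  @umap R n.+1 (ustep U) X Y f \o uunit (ustep U) X =1 uunit (ustep U) Y \o f.
Proof.
move=> strX strY fm z; have objX : @isobj R n.+1 X := strong_obj strX.
have [j [x ->]] := sys_cover (obj_system objX) z.
have [l /(_ _ (lexx _)) fl] := carries_large strY fm j; have [y fxy] := fl x.
have [v [vp xv]] := unit_stepE gU strX x; have [w [wp yw]] := unit_stepE gU strY y.
have [w' [vw' wp']] := umap_step_carries gU strX strY fm fl v.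
rewrite /= xv fxy yw; apply: etrans vw' _.
congr (inc (ulim U Y) l _); apply: (sys_prj_inj (ulim_system gU strY)) => k kl.
have [i [ij /(_ _ (lexx _)) [g fg]]] := ismor_induces objX strY fm fl kl.
rewrite (wp' _ _ _ ij kl fg) vp // wp // -(inducesE strY fg kl fxy).
exact: (reg_nat gU (strong_quo strX ij) (strong_quo strY kl) fg.2).
Qed.

Lemma step_inj X : @strong R n.+1 X -> injective (uunit (ustep U) X).
Proof.
move=> strX; have objX : @isobj R n.+1 X := strong_obj strX.
have sX := obj_system objX; have sU := ulim_system gU strX.
apply: raddf_inj => z; have [j [x ->]] := sys_cover sX z.
have [y [yp xy]] := unit_stepE gU strX x => x0.
have [j' [jj' y0]] := sys_zero sU (etrans (esym xy) x0).
have [x' [<- xx']] := sys_extend sX x jj'.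
rewrite (_ : x' = 0) ?linear0 //; apply: (sys_sep sX) => k kj'.
have [i [ij ik]] := sys_lower sX j k.
rewrite -(xx' i) //; apply: (reg_inj gU (strong_quo strX kj')).
have := reg_nat gU (strong_quo strX ij) (strong_quo strX kj')
  (obj_tr_mor objX ij kj' ik jj') (prj X i j x).
rewrite /= => <-; rewrite -ulim_tr // -yp // y0 // linear0 //.
Qed.

Lemma regular_step : @regular R n.+1 (ustep U).
Proof.
split.
- exact: step_id.
- exact: step_square.
- exact: step_mor.
- exact: step_nat.
- exact: step_inj.
move=> Z X g strX; apply: (@ismor_post_level R n X (ulim U X) id (fun i j => uunit U (quo X i j))) => //.
- by move=> k; exists k.
- by move=> j x; apply: unit_stepE.
by move=> i j W h ij; apply: (reg_post gU (strong_quo strX ij)).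
Qed.

End RegularStep.

(** * Natural transformations *)

(** Natural transformations compatible with the units. The last two clauses, for arbitrary
    [Z], say that [psi X] is a morphism in a form that passes to subquotients, although
    [fob U X] and [fob V X] are not known to be objects. *)
Record trans (R : comPzRingType) n (U V : ufunctor (lvl R n))
    (psi : forall X, {linear car (fob U X) -> car (fob V X)}) : Prop := Trans {
  trans_nat : forall (X Y : ob (lvl R n)) (f : {linear car X -> car Y}),
    strong X -> strong Y -> ismor f -> psi Y \o umap U f =1 umap V f \o psi X;
  trans_unit : forall X : ob (lvl R n), strong X -> psi X \o uunit U X =1 uunit V X;
  trans_post : forall (Z X : ob (lvl R n)) (g : {linear car Z -> car (fob U X)}),
    strong X -> ismor g -> ismor (psi X \o g);
  trans_pre : forall (X Z : ob (lvl R n)) (g : {linear car (fob V X) -> car Z}),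
    strong X -> ismor g -> ismor (g \o psi X)
}.

Definition tstep (R : comPzRingType) n (U V : ufunctor (lvl R n))
    (psi : forall X, {linear car (fob U X) -> car (fob V X)}) (X : fmod (lvl R n)) :
    {linear tot (ulim U X) -> tot (ulim V X)} :=
  lim_unit (X := ulim U X) (Y := ulim V X) (c := id) (fun i j => psi (quo X i j)).

Section TransStep.
Variables (R : comPzRingType) (n : nat).
Implicit Types X Y Z : fmod (lvl R n).

Lemma tstepE (U V : ufunctor (lvl R n)) psi : regular U -> regular V -> @trans R n U V psi ->
  forall X, @strong R n.+1 X ->
  @levelwise R n (ulim U X) (ulim V X) id (fun i j => psi (quo X i j)) (tstep psi X).
Proof.
move=> gU gV tpsi X strX; apply: lim_unitE => //.
- exact: ulim_system.
- exact: ulim_system.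
- exact: ulim_complete.
- by move=> k; exists k.
move=> i j k l ij kl ik jl a; rewrite !ulim_tr //.
have S := strong_quo strX; symmetry.
exact: (trans_nat tpsi (S _ _ ij) (S _ _ kl) (obj_tr_mor (strong_obj strX) ij kl ik jl)).
Qed.

Lemma trans_step (U V : ufunctor (lvl R n)) psi : regular U -> regular V -> @trans R n U V psi ->
  @trans R n.+1 (ustep U) (ustep V) (tstep psi).
Proof.
move=> gU gV tpsi; split.
- move=> X Y f strX strY fm z; have objX : @isobj R n.+1 X := strong_obj strX.
  have [j [x ->]] := sys_cover (ulim_system gU strX) z.
  have [l /(_ _ (lexx _)) fl] := carries_large strY fm j.
  have [y [xy yp]] := umap_step_carries gU strX strY fm fl x.
  have [w [wp yw]] := tstepE gU gV tpsi strY y.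
  have [v [vp xv]] := tstepE gU gV tpsi strX x.
  have [w' [vw' wp']] := umap_step_carries gV strX strY fm fl v.
  have e1 : tstep psi Y (@umap R n.+1 (ustep U) X Y f (inc (ulim U X) j x)) = inc (ulim V Y) l w.
    by rewrite -yw -xy.
  have e2 : @umap R n.+1 (ustep V) X Y f (tstep psi X (inc (ulim U X) j x)) = inc (ulim V Y) l w'.
    by rewrite -vw' -xv.
  apply: etrans e1 _; apply: etrans (esym e2).
  congr (inc (ulim V Y) l _); apply: (sys_prj_inj (ulim_system gV strY)) => k kl.
  have [i [ij /(_ _ (lexx _)) [g fg]]] := ismor_induces objX strY fm fl kl.
  rewrite (wp _ kl) (yp _ _ _ ij kl fg) (wp' _ _ _ ij kl fg) (vp _ ij).
  exact: (trans_nat tpsi (strong_quo strX ij) (strong_quo strY kl) fg.2).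
- move=> X strX z; have objX : @isobj R n.+1 X := strong_obj strX.
  have [j [x ->]] := sys_cover (obj_system objX) z.
  have [u [up xu]] := unit_stepE gU strX x; have [v [vp xv]] := unit_stepE gV strX x.
  have [w [wp uw]] := tstepE gU gV tpsi strX u.
  have e1 : tstep psi X (uunit (ustep U) X (inc X j x)) = inc (ulim V X) j w.
    by rewrite -uw -xu.
  apply: etrans e1 _; apply: etrans (esym xv).
  congr (inc (ulim V X) j _); apply: (sys_prj_inj (ulim_system gV strX)) => i ij.
  rewrite (wp _ ij) up // vp //.
  exact: (trans_unit tpsi (strong_quo strX ij)).
- move=> Z X g strX; apply: (@ismor_post_level R n (ulim U X) (ulim V X) id
    (fun i j => psi (quo X i j)) (tstep psi X)) => //.
  - by move=> k; exists k.
  - exact: tstepE.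
  by move=> i j W h ij; apply: (trans_post tpsi (strong_quo strX ij)).
move=> X Z g strX; apply: (@ismor_pre_level R n (ulim U X) (ulim V X) id
  (fun i j => psi (quo X i j)) (tstep psi X)) => //.
- by move=> k; exists k.
- exact: tstepE.
by move=> i j W h ij; apply: (trans_pre tpsi (strong_quo strX ij)).
Qed.

Lemma tstepK (U V : ufunctor (lvl R n)) psi phi : regular U -> regular V ->
  @trans R n U V psi -> @trans R n V U phi ->
  (forall X : ob (lvl R n), strong X -> cancel (psi X) (phi X)) ->
  forall X, @strong R n.+1 X -> cancel (tstep psi X) (tstep phi X).
Proof.
move=> gU gV tpsi tphi psiK X strX z.
have [j [x ->]] := sys_cover (ulim_system gU strX) z.
have [y [yp ->]] := tstepE gU gV tpsi strX x.
have [w [wp ->]] := tstepE gV gU tphi strX y.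
congr (inc (ulim U X) j _); apply: (sys_prj_inj (ulim_system gU strX)) => i ij.
by rewrite (wp _ ij) (yp _ ij) psiK //; apply: strong_quo.
Qed.

End TransStep.

Definition equivalent (R : comPzRingType) n (U V : ufunctor (lvl R n)) : Prop :=
  exists psi phi, [/\ trans (U := U) (V := V) psi, trans (U := V) (V := U) phi,
    forall X : ob (lvl R n), strong X -> cancel (psi X) (phi X) &
    forall X : ob (lvl R n), strong X -> cancel (phi X) (psi X)].

Lemma equivalent_step (R : comPzRingType) n (U V : ufunctor (lvl R n)) :
  regular U -> regular V -> equivalent U V ->
  @equivalent R n.+1 (ustep U) (ustep V).
Proof.
move=> gU gV [psi [phi [tpsi tphi psiK phiK]]].
exists (tstep psi), (tstep phi); split.
- exact: trans_step.
- exact: trans_step.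
- exact: tstepK.
- exact: tstepK.
Qed.

(** * The recursion for the double dual *)

Section Recursion.
Variable R : comPzRingType.

Definition barU n : ufunctor (lvl R n) := UFunctor (ufun := completion R n) (@natinj R n).

Definition bidualU n : ufunctor (lvl R n) :=
  UFunctor (ufun := Functor (fob := fun X => hat (hat X))
    (fun X Y h => carrow (dual R n) (carrow (dual R n) h))) (@delta R n).

Lemma barU_step n : barU n.+1 = ustep (barU n).
Proof. by []. Qed.

(** An order structure packed with the maps that identify its carrier with [T]. In this
    form the equality of an order with its double opposite can be stated and rewritten
    with, although the two orders have different displays. *)
Record reindexing (T : Type) := Reindexing {
  re_disp : Order.disp_t; re_idx : porderType re_disp;
  re_to : re_idx -> T; re_from : T -> re_idx;
  re_fromK : cancel re_from re_to }.

(** The two structures become convertible once all the records in [I] are exposed. *)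
Lemma dualK d (I : porderType d) :
  @Reindexing I (Order.dual_display (Order.dual_display d)) ((I^d)%O^d)%O id id (fun=> erefl) =
  @Reindexing I _ I id id (fun=> erefl).
Proof.
by destruct d as [a b], I as [S [c1 c2 c3 c4]]; destruct c1, c2, c3, c4.
Qed.

(** The unit, transported along the equalities of indices. *)
Definition unit_along (C : level R) (U : ufunctor C) (X : fmod C)
    (i i' j j' : idx X) (ii' : i' = i) (jj' : j' = j) :
    {linear car (quo X i j) -> car (fob U (quo X i' j'))} :=
  match esym ii' in _ = i', esym jj' in _ = j'
    return {linear car (quo X i j) -> car (fob U (quo X i' j'))} with
  | erefl, erefl => uunit U (quo X i j)
  end.

(** The step [ustep], with the limits taken over reindexed filtrations: it interpolates
    between the double dual, whose index set is a double opposite, and [ustep]. *)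
Definition ustep_along (w : forall d (I : porderType d), reindexing I) (C : level R)
    (U : ufunctor C) : ufunctor (filtered C) :=
  let o (X : fmod C) := let r := w _ (idx X) in
    lim_fmod (I := re_idx r)
      (E := fun i j => fob U (quo X (re_to i) (re_to j)))
      (fun i j k l => farrow U (trn X (re_to i) (re_to j) (re_to k) (re_to l))) in
  @UFunctor R (filtered C)
    (@Functor R (filtered C) o (fun (X Y : fmod C) (h : farr X Y) =>
      let S (i i' : idx (o X)) (j j' : idx (o Y)) := [set farrow U f | f in
         sarr h (re_to i) (re_to i') (re_to j) (re_to j')]%classic in
      @FArr R C (o X) (o Y) (lim_map (X := o X) (Y := o Y) S) S))
    (fun X : fmod C => let r := w _ (idx X) in
     lim_unit (X := X) (Y := o X) (c := @re_from _ r)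
       (fun i j => unit_along U (@re_fromK _ r i) (@re_fromK _ r j))).

Definition along_id d (I : porderType d) := @Reindexing I _ I id id (fun=> erefl).
Definition along_dual d (I : porderType d) :=
  @Reindexing I (Order.dual_display (Order.dual_display d)) ((I^d)%O^d)%O id id (fun=> erefl).

Lemma ustep_along_id (C : level R) (U : ufunctor C) : ustep_along along_id U = ustep U.
Proof. by []. Qed.

(** On subquotients the dual of the dual is the double dual of a subquotient of the given
    object, so the double dual obeys the same recursion as the completion. *)
Lemma bidualU_step n : bidualU n.+1 = ustep (bidualU n).
Proof.
rewrite -ustep_along_id.
have <- : along_dual = along_id.
  by apply: functional_extensionality_dep => d; apply: functional_extensionality_dep => I;
     apply: dualK.
pose F := farrow (ustep_along along_dual (bidualU n)).
have FE : (fun (X Y : ob (lvl R n.+1)) (h : arr X Y) =>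
    carrow (dual R n.+1) (carrow (dual R n.+1) h)) = F.
  apply: functional_extensionality_dep => X; apply: functional_extensionality_dep => Y.
  apply: functional_extensionality_dep => h.
  pose o := fob (ustep_along along_dual (bidualU n)).
  pose S (i i' : idx (o X)) (j j' : idx (o Y)) :=
    [set carrow (dual R n) f | f in [set carrow (dual R n) f | f in sarr h i i' j j']]%classic.
  pose S' (i i' : idx (o X)) (j j' : idx (o Y)) :=
    [set carrow (dual R n) (carrow (dual R n) f) | f in sarr h i i' j j']%classic.
  have SS' : S = S'.
    do 4![apply: functional_extensionality_dep => ?].
    exact: image_comp.
  exact: (f_equal (fun S => @FArr R (lvl R n) (o X) (o Y) (lim_map (X := o X) (Y := o Y) S) S) SS').
exact: (f_equal (fun a => @UFunctor R (lvl R n.+1) (Functor (fob := fun X => hat (hat X)) a) (@delta R n.+1)) FE).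
Qed.
End Recursion.

(** * The inductions *)

Section Base.
Variable R : comPzRingType.

Lemma regular_bar0 : regular (barU R 0).
Proof. by split. Qed.

Lemma regular_bidual0 : regular (bidualU R 0).
Proof.
split=> //.
- by move=> X _ phi; apply: character_ext => chi; congr (phi _); apply: character_ext.
- move=> X Y Y' Z f g f' g' _ _ _ _ _ _ _ _ gf phi; apply: character_ext => chi.
  by congr (phi _); apply: character_ext => x; congr (chi _); apply: gf.
- by move=> X Y f _ _ _ x; apply: character_ext.
- by move=> X finX; apply: char_ev_inj.
Qed.

Lemma char_ev_inverse (A : lmodType R) : exists g : {linear character (character A) -> A},
  finite_set [set: A] -> cancel (@char_ev R A) g /\ cancel g (@char_ev R A).
Proof.
have [finA|] := pselect (finite_set [set: A]); last by exists \0.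
have /(_ _)/cid - g phi := char_ev_surj finA phi.
pose h phi := projT1 (g phi); have hK : cancel h (@char_ev R A).
  by move=> phi; rewrite /h; case: (g phi).
have h_lin : linear h.
  by move=> a u v; apply: (char_ev_inj finA); rewrite hK linearP /= !hK.
exists (HB.pack_for {linear character (character A) -> A} h
  (GRing.isLinear.Build R (character (character A)) A _ h h_lin)).
move=> _; split; last exact: hK.
by move=> x; apply: (char_ev_inj finA); apply: hK.
Qed.

Lemma equivalent0 : equivalent (bidualU R 0) (barU R 0).
Proof.
have /(_ _)/cid - g := char_ev_inverse.
pose psi A := projT1 (g A).
have gK (A : ob (lvl R 0)) : strong A -> cancel (@char_ev R A) (psi A) /\ cancel (psi A) (@char_ev R A).
  by rewrite /psi; case: (g A).
exists psi, (@char_ev R); split.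
- split=> // [X Y f sX sY _ phi|X sX x]; last exact: (gK X sX).1.
  have [Xl Xr] := gK X sX; have [Yl Yr] := gK Y sY.
  rewrite /= -[phi]Xr; apply: (can_inj Yl).
  rewrite [LHS]Yr Xr.
  by rewrite -{1}[phi]Xr; apply: character_ext.
- split=> // X Y f sX sY _ x; exact: character_ext.
- by move=> X /gK[].
- by move=> X /gK[].
Qed.

Lemma regular_bar n : regular (barU R n).
Proof. by elim: n => [|n IH]; [exact: regular_bar0|rewrite barU_step; exact: regular_step]. Qed.

Lemma regular_bidual n : regular (bidualU R n).
Proof.
elim: n => [|n IH]; [exact: regular_bidual0|rewrite bidualU_step; exact: regular_step].
Qed.

Lemma bidual_bar n : equivalent (bidualU R n) (barU R n).
Proof.
elim: n => [|n IH]; first exact: equivalent0.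
rewrite bidualU_step barU_step; apply: equivalent_step IH.
  exact: regular_bidual.
exact: regular_bar.
Qed.

End Base.

Theorem mainTheorem2 (R : comPzRingType) (n : nat) :
  exists psi : forall A : ob (lvl R n), {linear car (hat (hat A)) -> car (bar A)},
    [/\ forall A : ob (lvl R n), strong A ->
          [/\ is_iso (psi A), psi A \o delta A =1 natinj A,
              ismor (natinj A) & injective (natinj A)],
        forall (A B : ob (lvl R n)) (f : {linear car A -> car B}),
          strong A -> strong B -> ismor f ->
          psi B \o hathat_map f =1 bar_map f \o psi A,
        forall A : ob (lvl R n), strong A -> complete A -> is_iso (delta A) &
        forall (A B : ob (lvl R n)) (f : {linear car A -> car B}),
          strong A -> strong B -> ismor f ->
          hathat_map f \o delta A =1 delta B \o f].
Proof.
have gH := regular_bidual R n; have gB := regular_bar R n.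
have [psi [phi [tpsi tphi psiK phiK]]] := bidual_bar R n.
have idm (U : ufunctor (lvl R n)) : regular U -> forall A : ob (lvl R n), strong A ->
    ismor (idfun : {linear car (fob U A) -> car (fob U A)}).
  move=> gU A sA; rewrite -(_ : umap U (idfun : {linear car A -> car A}) = idfun).
    exact: (reg_mor gU sA sA (ismor_id (strong_obj sA))).
  by apply: linear_ext; apply: (reg_id gU sA).
(* [f] and [f \o idfun] are equal, but not convertible as linear maps *)
have comp_id (X Y : ob (lvl R n)) (f : {linear car X -> car Y}) :
    ismor (f \o (idfun : {linear car X -> car X})) -> ismor f.
  by rewrite (_ : f \o idfun = f :> {linear _ -> _}) //; apply: linear_ext.
exists psi; split.
- move=> A sA; split.
  + split; first exact: (comp_id _ _ _ (trans_post tpsi sA (idm _ gH A sA))).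
    exists (phi A); split; [|exact: psiK|exact: phiK].
    exact: (comp_id _ _ _ (trans_post tphi sA (idm _ gB A sA))).
  + exact: (trans_unit tpsi sA).
  + exact: (comp_id _ _ _ (reg_post gB sA (ismor_id (strong_obj sA)))).
  + exact: (reg_inj gB sA).
- move=> A B f sA sB fm; exact: (trans_nat tpsi sA sB fm).
- move=> A sA [_ [nu [num nuK Knu]]]; split.
    exact: (comp_id _ _ _ (reg_post gH sA (ismor_id (strong_obj sA)))).
  have dE := trans_unit tpsi sA.
  exists (nu \o psi A); split.
  + exact: (trans_pre tpsi sA num).
  + by move=> x; rewrite /= -[RHS]nuK; congr (nu _); apply: dE.
  + move=> y; apply: (can_inj (psiK A sA)).
    by apply: etrans (dE _) _; apply: Knu.
- move=> A B f sA sB fm; exact: (reg_nat gH sA sB fm).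
Qed.
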